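(* Let $\mathbb{NG}$ denote the noncommutative Gurariy space. If an operator space $X$ satisfies $d_{cb}(X,\mathbb{NG})=1$, then $X$ is completely isometrically isomorphic to $\mathbb{NG}$.
   Context: Operator spaces are (complete, complex) operator spaces; $\|\cdot\|_{cb}$ is the completely bounded norm. A cb-isomorphism between operator spaces is a linear bijection $\phi$ such that $\phi$ and $\phi^{-1}$ are completely bounded. For operator spaces $V,W$, the completely bounded Banach-Mazur distance is $d_{cb}(V,W)=\inf\{\|\phi\|_{cb}\|\phi^{-1}\|_{cb} : \phi:V\to W \text{ is a cb-isomorphism}\}$ (with $\inf\emptyset=\infty$). An operator space $X$ is called $c$-exact if for every finite dimensional subspace $E$ of $X$ and every $\varepsilon>0$ there exist $n$ and a subspace $F$ of $M_n(\mathbb{C})$ with $d_{cb}(E,F)<c+\varepsilon$. A separable $1$-exact operator space $X$ is a noncommutative Gurariy space if: whenever $F$ is a finite dimensional $1$-exact operator space, $E\subseteq F$ and $E'\subseteq X$ are subspaces, and $u:E\to E'$ is a cb-isomorphism, then for any $\delta>0$ there exist a subspace $F'\subseteq X$ containing $E'$ and a linear isomorphism $\widetilde{u}:F\to F'$ such that $\widetilde{u}|_E=u$ and $\|\widetilde{u}\|_{cb}\|\widetilde{u}^{-1}\|_{cb}<(1+\delta)\|u\|_{cb}\|u^{-1}\|_{cb}$. Convention: for a map $u$ between zero spaces, the product $\|u\|_{cb}\|u^{-1}\|_{cb}$ is understood to be $1$. It is known that a noncommutative Gurariy space exists and is unique up to completely isometric isomorphism; it is denoted by $\mathbb{NG}$.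 *)

(* Defs.v *)
From HB Require Import structures.
From mathcomp Require Import all_boot all_order all_algebra ring lra.
From mathcomp Require Import complex.
From mathcomp Require Import all_classical all_reals ereal.
From mathcomp Require Import topology normedtype sequences.

Set Implicit Arguments.
Unset Strict Implicit.
Unset Printing Implicit Defensive.

Import Order.TTheory GRing.Theory Num.Theory.
Import numFieldNormedType.Exports.

Local Open Scope classical_set_scope.
Local Open Scope complex_scope.
Local Open Scope ring_scope.

(* The modulus of a complex number, as an element of [R]. *)
Notation cnorm := Normc.normc.

Section OperatorNorm.
Context {R : realType}.

Definition l2sq n (x : 'cV[R[i]]_n) : R := \sum_i cnorm (x i 0) ^+ 2.

Definition l2norm n (x : 'cV[R[i]]_n) : R := Num.sqrt (l2sq x).

Definition mxopnorm m n (A : 'M[R[i]]_(m, n)) : R :=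
  sup [set l2norm (A *m x) | x in [set x : 'cV[R[i]]_n | l2norm x <= 1]].

Lemma cnorm_ge0 (z : R[i]) : 0 <= cnorm z.
Proof. by case: z => a b; rewrite sqrtr_ge0. Qed.

Lemma cnormE (z : R[i]) : `|z| = (cnorm z)%:C.
Proof. by case: z. Qed.

Lemma cnormD (y z : R[i]) : cnorm (y + z) <= cnorm y + cnorm z.
Proof. by have := ler_normD y z; rewrite !cnormE -rmorphD lecR. Qed.

Lemma cauchy_schwarz n (a b : 'I_n -> R) :
  (\sum_i a i * b i) ^+ 2 <= (\sum_i a i ^+ 2) * (\sum_i b i ^+ 2).
Proof.
set A := \sum_i a i ^+ 2; set B := \sum_i b i ^+ 2; set S := \sum_i _.
have B0 : 0 <= B by apply: sumr_ge0 => i _; exact: sqr_ge0.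
have [B0'|Bn0] := eqVneq B 0.
  have b0 i : b i = 0.
    apply/eqP; rewrite -sqrf_eq0; apply/eqP.
    by apply: (psumr_eq0P _ B0') => // j _; exact: sqr_ge0.
  rewrite [S]big1 => [|i _]; last by rewrite b0 mulr0.
  by rewrite expr0n B0' mulr0.
have Bp : 0 < B by rewrite lt_def Bn0.
have : 0 <= \sum_i (a i * B - b i * S) ^+ 2.
  by apply: sumr_ge0 => i _; exact: sqr_ge0.
have -> : \sum_i (a i * B - b i * S) ^+ 2 = B * (A * B - S ^+ 2).
  transitivity (\sum_i (a i ^+ 2 * B ^+ 2 - a i * b i * (2 * B * S)
     + b i ^+ 2 * S ^+ 2)); first by apply: eq_bigr => i _; ring.
  by rewrite big_split sumrB /= -!mulr_suml -/A -/B -/S; ring.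
by rewrite pmulr_rge0 // subr_ge0.
Qed.

Lemma l2sq_ge0 n (x : 'cV[R[i]]_n) : 0 <= l2sq x.
Proof. by apply: sumr_ge0 => i _; exact: sqr_ge0. Qed.

Lemma l2norm_ge0 n (x : 'cV[R[i]]_n) : 0 <= l2norm x.
Proof. exact: sqrtr_ge0. Qed.

Lemma l2normK n (x : 'cV[R[i]]_n) : l2norm x ^+ 2 = l2sq x.
Proof. by rewrite sqr_sqrtr ?l2sq_ge0. Qed.

Lemma l2norm_le n (x : 'cV[R[i]]_n) c :
  0 <= c -> (l2norm x <= c) = (l2sq x <= c ^+ 2).
Proof. by move=> c0; rewrite -l2normK ler_sqr ?nnegrE ?l2norm_ge0. Qed.

Lemma l2norm_eq0 n (x : 'cV[R[i]]_n) : l2norm x = 0 -> x = 0.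
Proof.
move=> x0; have := l2normK x; rewrite x0 expr0n /= => /esym s0.
apply/matrixP => i j; rewrite ord1 mxE; apply: Normc.eq0_normc.
apply/eqP; rewrite -sqrf_eq0; apply/eqP.
by apply: (psumr_eq0P _ s0) => // k _; exact: sqr_ge0.
Qed.

Lemma l2norm0 n : l2norm (0 : 'cV[R[i]]_n) = 0.
Proof.
by rewrite /l2norm [l2sq _]big1 ?sqrtr0 // => i _; rewrite mxE Normc.normc0 expr0n.
Qed.

Lemma l2normZ n a (x : 'cV[R[i]]_n) : l2norm (a *: x) = cnorm a * l2norm x.
Proof.
rewrite /l2norm -[X in X * _](ger0_norm (cnorm_ge0 a)) -sqrtr_sqr.
rewrite -sqrtrM ?sqr_ge0 // /l2sq mulr_sumr; congr Num.sqrt.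
by apply: eq_bigr => i _; rewrite mxE Normc.normcM exprMn.
Qed.

Lemma l2normD n (x y : 'cV[R[i]]_n) : l2norm (x + y) <= l2norm x + l2norm y.
Proof.
rewrite l2norm_le ?addr_ge0 ?l2norm_ge0 //.
rewrite sqrrD !l2normK.
apply: (@le_trans _ _ (l2sq x
    + (\sum_i cnorm (x i 0) * cnorm (y i 0)) *+ 2 + l2sq y)).
  rewrite /l2sq -sumrMnl -!big_split /=; apply: ler_sum => i _.
  by rewrite -sqrrD mxE ler_sqr ?nnegrE ?addr_ge0 ?cnorm_ge0 // cnormD.
rewrite lerD2r lerD2l lerMn2r /=.
have h : 0 <= l2norm x * l2norm y by rewrite mulr_ge0 ?l2norm_ge0.
apply: le_trans (ler_norm _) _.
rewrite -(ger0_norm h) -ler_sqr ?nnegrE ?normr_ge0 // !real_normK ?num_real //.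
by rewrite exprMn !l2normK cauchy_schwarz.
Qed.

Lemma l2norm_sum (I : Type) (r : seq I) n (F : I -> 'cV[R[i]]_n) :
  l2norm (\sum_(i <- r) F i) <= \sum_(i <- r) l2norm (F i).
Proof.
elim: r => [|i r IH]; first by rewrite !big_nil l2norm0.
by rewrite !big_cons (le_trans (l2normD _ _)) // lerD2l.
Qed.

Lemma cnorm_le_l2norm n (x : 'cV[R[i]]_n) i : cnorm (x i 0) <= l2norm x.
Proof.
rewrite -ler_sqr ?nnegrE ?cnorm_ge0 ?l2norm_ge0 // l2normK /l2sq (bigD1 i) //=.
by rewrite lerDl sumr_ge0 // => j _; exact: sqr_ge0.
Qed.

Lemma mxopnorm_bounded m n (A : 'M[R[i]]_(m, n)) (x : 'cV_n) :
  l2norm (A *m x) <= (\sum_j l2norm (col j A)) * l2norm x.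
Proof.
have -> : A *m x = \sum_j x j 0 *: col j A.
  apply/matrixP => i k; rewrite ord1 mxE summxE.
  by apply: eq_bigr => j _; rewrite !mxE mulrC.
rewrite (le_trans (l2norm_sum _ _)) // mulr_suml ler_sum // => j _.
by rewrite l2normZ mulrC ler_wpM2l ?l2norm_ge0 ?cnorm_le_l2norm.
Qed.

Lemma mxopnorm_has_sup m n (A : 'M[R[i]]_(m, n)) :
  has_sup [set l2norm (A *m x) | x in [set x : 'cV[R[i]]_n | l2norm x <= 1]].
Proof.
split; first by exists (l2norm (A *m 0)), 0 => //=; rewrite l2norm0 ler01.
exists (\sum_j l2norm (col j A)) => _ [x /= x1 <-].
rewrite (le_trans (mxopnorm_bounded _ _)) // ler_piMr // sumr_ge0 // => j _.
exact: l2norm_ge0.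
Qed.

Lemma mxopnorm_ge0 m n (A : 'M[R[i]]_(m, n)) : 0 <= mxopnorm A.
Proof.
apply: le_trans (sup_upper_bound (mxopnorm_has_sup A) _).
  exact: (l2norm_ge0 (A *m 0)).
by exists 0 => //=; rewrite l2norm0 ler01.
Qed.

Lemma mxopnorm_ub m n (A : 'M[R[i]]_(m, n)) (x : 'cV_n) :
  l2norm (A *m x) <= mxopnorm A * l2norm x.
Proof.
have [x0|xn0] := eqVneq (l2norm x) 0.
  by rewrite (l2norm_eq0 x0) mulmx0 !l2norm0 mulr0.
have xp : 0 < l2norm x by rewrite lt_def xn0 l2norm_ge0.
have cV : cnorm ((l2norm x)^-1)%:C = (l2norm x)^-1.
  by rewrite /= expr0n addr0 sqrtr_sqr ger0_norm // invr_ge0 l2norm_ge0.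
rewrite -ler_pdivrMr //.
apply: (sup_upper_bound (mxopnorm_has_sup A)).
exists (((l2norm x)^-1)%:C *: x) => /=.
  by rewrite l2normZ cV mulVf.
by rewrite -scalemxAr l2normZ cV mulrC.
Qed.

Lemma mxopnorm_le m n (A : 'M[R[i]]_(m, n)) c : 0 <= c ->
  (forall x, l2norm (A *m x) <= c * l2norm x) -> mxopnorm A <= c.
Proof.
move=> c0 Ac; apply: ge_sup => [|_ [x /= x1 <-]].
  by case: (mxopnorm_has_sup A).
by rewrite (le_trans (Ac _)) // ler_piMr.
Qed.

Lemma mxopnormD m n (A B : 'M[R[i]]_(m, n)) :
  mxopnorm (A + B) <= mxopnorm A + mxopnorm B.
Proof.
apply: mxopnorm_le => [|x]; first by rewrite addr_ge0 ?mxopnorm_ge0.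
by rewrite mulmxDl (le_trans (l2normD _ _)) // mulrDl lerD ?mxopnorm_ub.
Qed.

Lemma mxopnormZ m n a (A : 'M[R[i]]_(m, n)) :
  mxopnorm (a *: A) = cnorm a * mxopnorm A.
Proof.
have le b (B : 'M[R[i]]_(m, n)) : mxopnorm (b *: B) <= cnorm b * mxopnorm B.
  apply: mxopnorm_le => [|x]; first by rewrite mulr_ge0 ?cnorm_ge0 ?mxopnorm_ge0.
  by rewrite -scalemxAl l2normZ -mulrA ler_wpM2l ?cnorm_ge0 ?mxopnorm_ub.
apply/eqP; rewrite eq_le le /=.
have [->|a0] := eqVneq a 0; first by rewrite Normc.normc0 mul0r mxopnorm_ge0.
have ca : 0 < cnorm a.
  rewrite lt_def cnorm_ge0 andbT; apply: contra_neq a0; exact: Normc.eq0_normc.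
rewrite mulrC -ler_pdivlMr // mulrC -Normc.normcV.
by apply: le_trans (le _ _); rewrite scalerA mulVf // scale1r.
Qed.

Lemma mxopnorm_eq0 m n (A : 'M[R[i]]_(m, n)) : mxopnorm A = 0 -> A = 0.
Proof.
move=> A0; apply/matrixP => i j; rewrite mxE.
have : A *m delta_mx j 0 = 0 :> 'cV_m.
  apply: l2norm_eq0; apply/eqP; rewrite eq_le l2norm_ge0 andbT.
  by rewrite (le_trans (mxopnorm_ub _ _)) // A0 mul0r.
by rewrite -colE => /matrixP/(_ i 0); rewrite !mxE.
Qed.

Lemma mxopnormM m n p (A : 'M[R[i]]_(m, n)) (B : 'M_(n, p)) :
  mxopnorm (A *m B) <= mxopnorm A * mxopnorm B.
Proof.
apply: mxopnorm_le => [|x]; first by rewrite mulr_ge0 ?mxopnorm_ge0.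
rewrite -mulmxA (le_trans (mxopnorm_ub _ _)) // -mulrA.
by rewrite ler_wpM2l ?mxopnorm_ge0 ?mxopnorm_ub.
Qed.

End OperatorNorm.

(* [alpha x beta] for scalar matrices [alpha], [beta] and [x] in [M_n(V)]. *)
Definition mxact (K : pzRingType) (V : lmodType K) m n p q
    (alpha : 'M[K]_(m, n)) (x : 'M[V]_(n, p)) (beta : 'M[K]_(p, q)) :
    'M[V]_(m, q) :=
  \matrix_(i, j) \sum_k \sum_l (alpha i k * beta l j) *: x k l.

(* Abstract operator spaces: matrix norms subject to Ruan's axioms.  Norm   *)
(* completeness is the separate predicate [os_complete], so that arbitrary  *)
(* linear subspaces are again instances.                                    *)
HB.mixin Record isOpSpace (R : realType) V of GRing.Lmodule R[i] V := {
  mxnorm : forall n : nat, 'M[V]_n -> R;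
  mxnormD : forall n (x y : 'M[V]_n),
    mxnorm n (x + y) <= mxnorm n x + mxnorm n y;
  mxnormZ : forall n (a : R[i]) (x : 'M[V]_n),
    mxnorm n (map_mx ( *:%R a) x) = cnorm a * mxnorm n x;
  mxnorm_eq0 : forall n (x : 'M[V]_n), mxnorm n x = 0 -> x = 0;
  mxnorm_dsum : forall m n (x : 'M[V]_m) (y : 'M[V]_n),
    mxnorm (m + n)%N (block_mx x 0 0 y) = Num.max (mxnorm m x) (mxnorm n y);
  mxnorm_act : forall m n
    (alpha : 'M[R[i]]_(m, n)) (x : 'M[V]_n) (beta : 'M[R[i]]_(n, m)),
    mxnorm m (mxact alpha x beta)
      <= mxopnorm alpha * mxnorm n x * mxopnorm beta
}.

#[short(type="opSpaceType")]
HB.structure Definition OpSpace (R : realType) :=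
  { V of isOpSpace R V & GRing.Lmodule R[i] V }.

Arguments mxnorm {R V n} x : rename.


Section MatrixSpace.
Context {R : realType} {n : nat}.

(* [M_k(M_n(C))] is identified with [M_(kn)(C)]. *)
Definition blocknorm k (x : 'M['M[R[i]]_n]_k) : R :=
  mxopnorm (\mxblock_(i < k, j < k) x i j).

Let amp k m (alpha : 'M[R[i]]_(k, m)) :=
  \mxblock_(i < k, j < m) ((alpha i j)%:M : 'M[R[i]]_n).

Lemma l2sq_mxcol k (z : 'I_k -> 'cV[R[i]]_n) :
  l2sq (\mxcol_i z i) = \sum_i l2sq (z i).
Proof.
rewrite /l2sq sig_big_dep /= (reindex _ tagnat.sig_bij_on) /=.
by apply: eq_bigr => l _; rewrite !mxE.
Qed.

Lemma mxopnorm_amp k m (alpha : 'M[R[i]]_(k, m)) :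
  mxopnorm (amp alpha) <= mxopnorm alpha.
Proof.
apply: mxopnorm_le => [|x]; first exact: mxopnorm_ge0.
rewrite l2norm_le; last by rewrite mulr_ge0 ?mxopnorm_ge0 ?l2norm_ge0.
rewrite exprMn l2normK -[x]submxcolK /amp mul_mxblock_mxrow !l2sq_mxcol.
set z := fun j => submxcol x j.
pose y (a : 'I_n) : 'cV[R[i]]_m := \col_j z j a 0.
have -> : \sum_i l2sq (submxcol x i) = \sum_a l2sq (y a).
  rewrite /l2sq exchange_big /=; apply: eq_bigr => a _.
  by apply: eq_bigr => j _; rewrite /y /z !mxE.
have -> : \sum_i l2sq (\sum_j (alpha i j)%:M *m submxcol x j)
    = \sum_a l2sq (alpha *m y a).
  rewrite /l2sq exchange_big /=; apply: eq_bigr => a _.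
  apply: eq_bigr => i _; congr (cnorm _ ^+ 2).
  rewrite summxE mxE; apply: eq_bigr => j _.
  by rewrite mul_scalar_mx /y /z !mxE.
rewrite mulr_sumr ler_sum // => a _.
rewrite -!l2normK -exprMn ler_sqr ?nnegrE ?mulr_ge0 ?mxopnorm_ge0 ?l2norm_ge0 //.
exact: mxopnorm_ub.
Qed.

Lemma blocknormD k (x y : 'M['M[R[i]]_n]_k) :
  blocknorm (x + y) <= blocknorm x + blocknorm y.
Proof.
rewrite /blocknorm; apply: le_trans (mxopnormD _ _); rewrite -mxblockD.
by rewrite le_eqVlt; apply/orP; left; apply/eqP; congr mxopnorm;
  apply: eq_mxblock => i j; rewrite mxE.
Qed.

Lemma blocknormZ k a (x : 'M['M[R[i]]_n]_k) :
  blocknorm (map_mx ( *:%R a) x) = cnorm a * blocknorm x.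
Proof.
rewrite /blocknorm -mxopnormZ; congr mxopnorm.
by apply/matrixP => i j; rewrite !mxE.
Qed.

Lemma blocknorm_eq0 k (x : 'M['M[R[i]]_n]_k) : blocknorm x = 0 -> x = 0.
Proof.
move/mxopnorm_eq0; rewrite -mxblock0 => /eq_mxblockP x0.
by apply/matrixP => i j; rewrite x0 mxE.
Qed.

Lemma blocknorm_act k m (alpha : 'M[R[i]]_(k, m)) (x : 'M['M[R[i]]_n]_m)
    (beta : 'M[R[i]]_(m, k)) :
  blocknorm (mxact alpha x beta)
    <= mxopnorm alpha * blocknorm x * mxopnorm beta.
Proof.
have -> : blocknorm (mxact alpha x beta)
    = mxopnorm (amp alpha *m (\mxblock_(i, j) x i j) *m amp beta).
  rewrite /blocknorm /amp !mul_mxblock; congr mxopnorm.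
  apply: eq_mxblock => i j; rewrite mxE exchange_big /=; apply: eq_bigr => l _.
  rewrite mulmx_suml; apply: eq_bigr => q _.
  by rewrite mul_scalar_mx mul_mx_scalar scalerA mulrC.
apply: le_trans (mxopnormM _ _) _.
apply: ler_pM; rewrite ?mxopnorm_ge0 ?mxopnorm_amp //.
apply: le_trans (mxopnormM _ _) _.
by apply: ler_pM; rewrite ?mxopnorm_ge0 ?mxopnorm_amp.
Qed.

Lemma blocknorm_dsum k m (x : 'M['M[R[i]]_n]_k) (y : 'M['M[R[i]]_n]_m) :
  blocknorm (block_mx x 0 0 y) = Num.max (blocknorm x) (blocknorm y).
Proof.
have blockE (z : 'I_(k + m) -> 'cV[R[i]]_n) :
  l2sq ((\mxblock_(i, j) block_mx x 0 0 y i j) *m \mxcol_j z j)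
  = l2sq ((\mxblock_(i, j) x i j) *m \mxcol_j z (lshift m j))
    + l2sq ((\mxblock_(i, j) y i j) *m \mxcol_j z (rshift k j)).
  rewrite !mul_mxblock_mxrow !l2sq_mxcol big_split_ord /=; congr (_ + _).
    apply: eq_bigr => i _; congr l2sq; rewrite big_split_ord /=.
    rewrite [X in _ + X]big1 ?addr0 => [|j _].
      by apply: eq_bigr => j _; rewrite block_mxEul.
    by rewrite block_mxEur mxE mul0mx.
  apply: eq_bigr => i _; congr l2sq; rewrite big_split_ord /=.
  rewrite big1 ?add0r => [|j _]; last by rewrite block_mxEdl mxE mul0mx.
  by apply: eq_bigr => j _; rewrite block_mxEdr.
have le_sq a b (A : 'M[R[i]]_(a, b)) v c : mxopnorm A <= c ->
    l2sq (A *m v) <= c ^+ 2 * l2sq v.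
  move=> Ac; have c0 : 0 <= c by rewrite (le_trans (mxopnorm_ge0 A)).
  rewrite -!l2normK -exprMn ler_sqr ?nnegrE ?mulr_ge0 ?l2norm_ge0 //.
  by rewrite (le_trans (mxopnorm_ub _ _)) // ler_wpM2r ?l2norm_ge0.
apply/eqP; rewrite eq_le ge_max; apply/and3P; split.
- apply: mxopnorm_le => [|v]; first by rewrite le_max mxopnorm_ge0.
  rewrite l2norm_le; last by rewrite mulr_ge0 ?l2norm_ge0 // le_max mxopnorm_ge0.
  rewrite exprMn l2normK -[v]submxcolK blockE [in leRHS]l2sq_mxcol.
  rewrite big_split_ord /= mulrDr -!l2sq_mxcol.
  by apply: lerD; apply: le_sq; rewrite le_max lexx ?orbT.
- apply: mxopnorm_le => [|v]; first exact: mxopnorm_ge0.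
  rewrite l2norm_le; last by rewrite mulr_ge0 ?mxopnorm_ge0 ?l2norm_ge0.
  rewrite exprMn l2normK.
  pose z (i : 'I_(k + m)) := if fintype.split i is inl j then submxcol v j else 0.
  have zl j : z (lshift m j) = submxcol v j.
    by rewrite /z (unsplitK (inl j : 'I_k + 'I_m)%type).
  have zr j : z (rshift k j) = 0.
    by rewrite /z (unsplitK (inr j : 'I_k + 'I_m)%type).
  have := le_sq _ _ _ (\mxcol_j z j) _ (lexx (blocknorm (block_mx x 0 0 y))).
  rewrite blockE l2sq_mxcol big_split_ord /=.
  under eq_mxcol do rewrite zl.
  under [X in _ * (X + _)]eq_bigr do rewrite zl.
  rewrite [X in _ * (_ + X)]big1 ?addr0 => [|j _]; last first.
    by rewrite zr -l2normK l2norm0 expr0n.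
  rewrite -l2sq_mxcol submxcolK; apply: le_trans.
  by rewrite lerDl l2sq_ge0.
- apply: mxopnorm_le => [|v]; first exact: mxopnorm_ge0.
  rewrite l2norm_le; last by rewrite mulr_ge0 ?mxopnorm_ge0 ?l2norm_ge0.
  rewrite exprMn l2normK.
  pose z (i : 'I_(k + m)) := if fintype.split i is inr j then submxcol v j else 0.
  have zl j : z (lshift m j) = 0.
    by rewrite /z (unsplitK (inl j : 'I_k + 'I_m)%type).
  have zr j : z (rshift k j) = submxcol v j.
    by rewrite /z (unsplitK (inr j : 'I_k + 'I_m)%type).
  have := le_sq _ _ _ (\mxcol_j z j) _ (lexx (blocknorm (block_mx x 0 0 y))).
  rewrite blockE l2sq_mxcol big_split_ord /=.
  rewrite [X in _ * (X + _)]big1 ?add0r => [|j _]; last first.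
    by rewrite zl -l2normK l2norm0 expr0n.
  under [X in _ * X]eq_bigr do rewrite zr.
  under [X in _ + l2sq (_ *m X)]eq_mxcol do rewrite zr.
  rewrite -l2sq_mxcol submxcolK; apply: le_trans.
  by rewrite lerDr l2sq_ge0.
Qed.

HB.instance Definition _ := isOpSpace.Build R 'M[R[i]]_n
  blocknormD blocknormZ blocknorm_eq0 blocknorm_dsum blocknorm_act.

End MatrixSpace.

(* A linear subspace [E], as an operator space with the inherited norms. *)
Definition subspace {R : realType} {V : opSpaceType R}
  (E : submodClosed V) : Type := {x : V | x \in E}.

Section Subspace.
Context {R : realType} {V : opSpaceType R} (E : submodClosed V).

HB.instance Definition _ := SubChoice.on (subspace E).
HB.instance Definition _ := [SubChoice_isSubLmodule of subspace E by <:].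

Definition subnorm n (x : 'M[subspace E]_n) : R := mxnorm (map_mx val x).

Lemma subnormD n (x y : 'M[subspace E]_n) :
  subnorm (x + y) <= subnorm x + subnorm y.
Proof. by rewrite /subnorm map_mxD mxnormD. Qed.

Lemma subnormZ n a (x : 'M[subspace E]_n) :
  subnorm (map_mx ( *:%R a) x) = cnorm a * subnorm x.
Proof.
rewrite /subnorm -mxnormZ; congr mxnorm.
by apply/matrixP => i j; rewrite !mxE linearZ.
Qed.

Lemma subnorm_eq0 n (x : 'M[subspace E]_n) : subnorm x = 0 -> x = 0.
Proof.
move/mxnorm_eq0 => /matrixP x0; apply/matrixP => i j.
by apply: val_inj; have := x0 i j; rewrite !mxE raddf0.
Qed.

Lemma subnorm_dsum m n (x : 'M[subspace E]_m) (y : 'M[subspace E]_n) :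
  subnorm (block_mx x 0 0 y) = Num.max (subnorm x) (subnorm y).
Proof. by rewrite /subnorm map_block_mx !map_mx0 mxnorm_dsum. Qed.

Lemma subnorm_act m n (alpha : 'M[R[i]]_(m, n)) (x : 'M[subspace E]_n)
    (beta : 'M[R[i]]_(n, m)) :
  subnorm (mxact alpha x beta)
    <= mxopnorm alpha * subnorm x * mxopnorm beta.
Proof.
have valact : map_mx val (mxact alpha x beta) = mxact alpha (map_mx val x) beta.
  apply/matrixP => i j; rewrite !mxE raddf_sum; apply: eq_bigr => k _.
  by rewrite raddf_sum; apply: eq_bigr => l _; rewrite mxE -linearZ.
by rewrite /subnorm valact; exact: mxnorm_act.
Qed.

HB.instance Definition _ := isOpSpace.Build R (subspace E)
  subnormD subnormZ subnorm_eq0 subnorm_dsum subnorm_act.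

End Subspace.

Section CompletelyBounded.
Context {R : realType}.
Implicit Types V W : opSpaceType R.

(* The norm of the [n]-th amplification [u_n : M_n(V) -> M_n(W)]. *)
Definition ampnorm V W (u : {linear V -> W}) n : \bar R :=
  ereal_sup [set (mxnorm (map_mx u x))%:E | x in [set x : 'M[V]_n | mxnorm x <= 1]].

Definition cbnorm V W (u : {linear V -> W}) : \bar R :=
  ereal_sup (range (ampnorm u)).

Definition completely_bounded V W (u : {linear V -> W}) : Prop :=
  (cbnorm u < +oo)%E.

Record linIso V W := LinIso {
  iso_fun :> {linear V -> W};
  iso_inv : {linear W -> V};
  iso_funK : cancel iso_fun iso_inv;
  iso_invK : cancel iso_inv iso_fun
}.

Definition cb_isomorphism V W (phi : linIso V W) : Prop :=
  completely_bounded phi /\ completely_bounded (iso_inv phi).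

(* [||phi||_cb ||phi^-1||_cb], read as 1 when the spaces are zero. *)
Definition distortion V W (phi : linIso V W) : \bar R :=
  if `[< forall x : V, x = 0 >] then 1%E
  else (cbnorm phi * cbnorm (iso_inv phi))%E.

(* The completely bounded Banach-Mazur distance; [ereal_inf set0] is [+oo]. *)
Definition d_cb V W : \bar R :=
  ereal_inf [set distortion phi | phi in [set phi : linIso V W | cb_isomorphism phi]].

Definition completely_isometrically_isomorphic V W : Prop :=
  exists phi : linIso V W, forall n (x : 'M[V]_n), mxnorm (map_mx phi x) = mxnorm x.

End CompletelyBounded.

Section Gurariy.
Context {R : realType}.
Implicit Types V : opSpaceType R.

Definition osnorm V (x : V) : R := mxnorm (const_mx x : 'M[V]_1).

Definition os_complete V : Prop := forall u : nat -> V,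
  (forall e : R, 0 < e -> \forall m & n \near \oo, osnorm (u m - u n) < e) ->
  exists l : V, osnorm (u n - l) @[n --> \oo] --> (0 : R).

Definition os_separable V : Prop := exists D : set V,
  countable D /\ forall (x : V) (e : R), 0 < e -> exists2 y, D y & osnorm (x - y) < e.

Definition finite_dimensional V : Prop :=
  exists (n : nat) (b : 'I_n -> V),
    forall x : V, exists c : 'I_n -> R[i], x = \sum_i c i *: b i.

Definition is_exact V (c : R) : Prop :=
  forall E : submodClosed V, finite_dimensional (subspace E) ->
  forall e : R, 0 < e ->
  exists (n : nat) (F : submodClosed 'M[R[i]]_n),
    (d_cb (subspace E) (subspace F) < (c + e)%:E)%E.

Definition extension_property V : Prop :=
  forall F : opSpaceType R, finite_dimensional F -> is_exact F 1 ->
  forall (E : submodClosed F) (E' : submodClosed V)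
    (u : linIso (subspace E) (subspace E')), cb_isomorphism u ->
  forall delta : R, 0 < delta ->
  exists (F' : submodClosed V) (u' : linIso F (subspace F')),
    [/\ {subset E' <= F'},
        (forall x : subspace E, val (u' (val x)) = val (u x)) &
        (distortion u' < (1 + delta)%:E * distortion u)%E].

Definition nc_gurariy V : Prop :=
  [/\ os_complete V, os_separable V, is_exact V 1 & extension_property V].

End Gurariy.

(* Main.v *)
(* Working with finite tuples of vectors up to complete equivalence avoids   *)
(* carrying subspaces around.  The extension property of NG, in tuple form,  *)
(* together with local embeddability into matrix algebras, is invariant under *)
(* [d_cb = 1], so X has it too, and it remains to show that two such spaces  *)
(* are completely isometric.  The extension property never improves the      *)
(* distortion of a map, so one corrects it first: if [a |-> b] has           *)
(* distortion about [1 + delta], almost embed [a] and [b] in [M_p] and [M_q] *)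
(* as [alpha], [beta] and place [diag(alpha, s beta)] and                    *)
(* [diag(s alpha, beta)] in [M_(p+q)] with [s = (1 + delta)^-2].  These are  *)
(* almost exact copies of [a] and [b] at distance [O(delta)]; extending from *)
(* the copy of [b] produces a tuple [O(delta)]-close to [b] and almost       *)
(* exactly equivalent to [a].  A back-and-forth along dense sequences then   *)
(* converges to a complete isometry.                                         *)

From HB Require Import structures.
From mathcomp Require Import all_boot all_order all_algebra ring lra.
From mathcomp Require Import complex.
From mathcomp Require Import all_classical all_reals ereal.
From mathcomp Require Import topology normedtype sequences.
Require Import Defs.

Set Implicit Arguments.
Unset Strict Implicit.
Unset Printing Implicit Defensive.

Import Order.TTheory GRing.Theory Num.Theory.
Import numFieldNormedType.Exports.

Local Open Scope classical_set_scope.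
Local Open Scope complex_scope.
Local Open Scope ring_scope.

(** Finite-dimensional data are handled as tuples: [a] and [b] are [similar] with constant [K] when
    [a i |-> b i] and its inverse, between the spans, have cb norm at most [K]. For NG, 1-exactness
    becomes [locally_matricial] ([exact_locally_matricial]) and the Gurariy property becomes
    [tuple_extension] ([extension_property_tuple]). Both tolerate an arbitrarily small loss, so
    almost isometric isomorphisms, suitably rescaled, carry them over to X, as they do separability.
    It then suffices that two complete separable spaces with both properties are completely
    isometric ([tuple_extension_isometric]).

    The obstacle is that an extension is no better than the map it extends, so errors would
    accumulate. [correct_and_extend] trades distortion for displacement: if [a] and [b] are similar
    with constant [1 + delta], then moving [b] by [O(delta)] makes it as nearly isometric to [a] as
    desired. Indeed [amalgamate] puts almost exact copies of both tuples into one matrix algebra at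
    distance [O(delta)], and extending from the copy of [b] keeps this distance up to a bounded
    factor.

    Summable displacements make the back-and-forth of [close_tuples_chain] converge to dense
    sequences in the two spaces. By [dominates_limit] these are similar with constant 1, and
    [completely_isometric_of_dense] extends their correspondence to the whole spaces. *)

Section MatrixNorms.
Context {R : realType}.
Implicit Types V W : opSpaceType R.

(** * Consequences of Ruan's axioms, and elements of [M_k(V)] with matrix coefficients *)

Lemma cnorm_real (r : R) : cnorm r%:C = `|r|.
Proof. by rewrite /= expr0n addr0 sqrtr_sqr. Qed.

Lemma cnormN1 : cnorm (- 1 : R[i]) = 1.
Proof. by rewrite /= oppr0 expr0n addr0 sqrtr_sqr normrN1. Qed.

Lemma mxnorm0 V k : mxnorm (0 : 'M[V]_k) = 0.
Proof.
have <- : map_mx ( *:%R (0 : R[i])) (0 : 'M[V]_k) = 0.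
  by apply/matrixP => r s; rewrite !mxE scale0r.
by rewrite mxnormZ Normc.normc0 mul0r.
Qed.

Lemma mxnormN V k (x : 'M[V]_k) : mxnorm (- x) = mxnorm x.
Proof.
have -> : - x = map_mx ( *:%R (- 1 : R[i])) x.
  by apply/matrixP => r s; rewrite !mxE scaleN1r.
by rewrite mxnormZ cnormN1 mul1r.
Qed.

Lemma mxnorm_ge0 V k (x : 'M[V]_k) : 0 <= mxnorm x.
Proof.
have := mxnormD _ x (- x).
by rewrite subrr mxnorm0 mxnormN -mulr2n pmulrn_lge0.
Qed.

Lemma mxnorm_sum V k (I : Type) (r : seq I) (P : pred I) (F : I -> 'M[V]_k) :
  mxnorm (\sum_(i <- r | P i) F i) <= \sum_(i <- r | P i) mxnorm (F i).
Proof.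
elim/big_ind2: _ => [|x a y b xa yb|//]; first by rewrite mxnorm0.
by rewrite (le_trans (mxnormD _ _ _)) // lerD.
Qed.

(** This is the element [\sum_i A_i (x) a_i] of the tensor product of [M_k] and [V], identified with
    [M_k(V)]. Tuples are total sequences of which the first [n] entries count, so that lengthening
    one needs no change of type. *)
Definition lincomb (V : lmodType R[i]) k n (A : nat -> 'M[R[i]]_k)
    (a : nat -> V) : 'M[V]_k :=
  \matrix_(r, s) \sum_(i < n) A i r s *: a i.

Lemma eq_lincomb (V : lmodType R[i]) k n (A B : nat -> 'M[R[i]]_k)
    (a b : nat -> V) :
  (forall i, (i < n)%N -> A i = B i) -> (forall i, (i < n)%N -> a i = b i) ->
  lincomb n A a = lincomb n B b.
Proof.
move=> AB ab; apply/matrixP => r s; rewrite !mxE.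
by apply: eq_bigr => i _; rewrite AB ?ab.
Qed.

Lemma map_lincomb (V W : lmodType R[i]) (f : {linear V -> W}) k n
    (A : nat -> 'M[R[i]]_k) (a : nat -> V) :
  map_mx f (lincomb n A a) = lincomb n A (f \o a).
Proof.
apply/matrixP => r s; rewrite !mxE linear_sum.
by apply: eq_bigr => i _; rewrite linearZ.
Qed.

Lemma lincombB (V : lmodType R[i]) k n (A : nat -> 'M[R[i]]_k)
    (a b : nat -> V) :
  lincomb n A (fun i => a i - b i) = lincomb n A a - lincomb n A b.
Proof.
apply/matrixP => r s; rewrite !mxE -sumrB.
by apply: eq_bigr => i _; rewrite scalerBr.
Qed.

Lemma lincombZ (V : lmodType R[i]) k n (A : nat -> 'M[R[i]]_k) c
    (a : nat -> V) :
  lincomb n A (fun i => c *: a i) = map_mx ( *:%R c) (lincomb n A a).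
Proof.
apply/matrixP => r s; rewrite !mxE scaler_sumr.
by apply: eq_bigr => i _; rewrite !scalerA mulrC.
Qed.

(** The scalars move from the vectors to the matrix coefficients; hence domination of a tuple passes
    to all tuples of linear combinations of it. *)
Lemma lincomb_substitution (V : lmodType R[i]) k n m (A : nat -> 'M[R[i]]_k)
    (C : nat -> nat -> R[i]) (a : nat -> V) :
  lincomb m A (fun j => \sum_(i < n) C j i *: a i)
  = lincomb n (fun i => \sum_(j < m) C j i *: A j) a.
Proof.
apply/matrixP => r s; rewrite !mxE.
under eq_bigr do rewrite scaler_sumr.
rewrite exchange_big /=; apply: eq_bigr => i _.
rewrite summxE scaler_suml; apply: eq_bigr => j _.
by rewrite scalerA mxE mulrC.
Qed.

Lemma osnorm_lincomb V n (c : nat -> R[i]) (a : nat -> V) :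
  osnorm (\sum_(i < n) c i *: a i) = mxnorm (lincomb n (fun i => (c i)%:M : 'M_1) a).
Proof.
rewrite /osnorm; congr mxnorm; apply/matrixP => r s; rewrite !mxE.
by apply: eq_bigr => i _; rewrite !ord1 mxE mulr1n.
Qed.

(* Ruan's second axiom applied to [A (x) x = \sum_s A e_s (x) x e_s^T]. *)
Lemma mxnorm_lincomb_le V k n (A : nat -> 'M[R[i]]_k) : exists2 C : R,
  0 <= C & forall a : nat -> V,
    mxnorm (lincomb n A a) <= C * \sum_(i < n) osnorm (a i).
Proof.
pose c i := \sum_s mxopnorm (col s (A i)) * mxopnorm (delta_mx 0 s : 'rV[R[i]]_k).
have c0 i : 0 <= c i.
  by apply: sumr_ge0 => s _; rewrite mulr_ge0 ?mxopnorm_ge0.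
exists (\sum_(i < n) c i) => [|a]; first exact: sumr_ge0.
have -> : lincomb n A a = \sum_(i < n) \sum_s
    mxact (col s (A i)) (const_mx (a i) : 'M_1) (delta_mx 0 s).
  apply/matrixP => r t; rewrite !mxE summxE; apply: eq_bigr => i _.
  rewrite summxE (bigD1 t) //= big1 ?addr0 => [|s st].
    by rewrite mxE !big_ord1 !mxE !eqxx mulr1.
  by rewrite mxE !big_ord1 !mxE eqxx eq_sym (negbTE st) mulr0 scale0r.
rewrite (le_trans (mxnorm_sum _ _ _)) // mulr_sumr ler_sum // => i _.
apply: (@le_trans _ _ (c i * osnorm (a i))); last first.
  by rewrite ler_wpM2r ?mxnorm_ge0 // [leRHS](bigD1 i) //= lerDl sumr_ge0.
rewrite (le_trans (mxnorm_sum _ _ _)) // mulr_suml ler_sum // => s _.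
by rewrite mulrAC mxnorm_act.
Qed.

Lemma osnorm_ge0 V (x : V) : 0 <= osnorm x.
Proof. exact: mxnorm_ge0. Qed.

Lemma osnormD V (x y : V) : osnorm (x + y) <= osnorm x + osnorm y.
Proof.
apply: le_trans (mxnormD _ _ _); rewrite /osnorm le_eqVlt; apply/orP; left.
by apply/eqP; congr mxnorm; apply/matrixP => r s; rewrite !mxE.
Qed.

Lemma osnormZ V c (x : V) : osnorm (c *: x) = cnorm c * osnorm x.
Proof.
by rewrite -mxnormZ; congr mxnorm; apply/matrixP => r s; rewrite !mxE.
Qed.

Lemma osnorm0 V : osnorm (0 : V) = 0.
Proof. by rewrite -(scale0r (0 : V)) osnormZ Normc.normc0 mul0r. Qed.

Lemma osnorm_eq0 V (x : V) : osnorm x = 0 -> x = 0.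
Proof. by move/mxnorm_eq0/matrixP/(_ 0 0); rewrite !mxE. Qed.

Lemma osnormN V (x : V) : osnorm (- x) = osnorm x.
Proof. by rewrite -scaleN1r osnormZ cnormN1 mul1r. Qed.

Lemma osnorm_distC V (x y : V) : osnorm (x - y) = osnorm (y - x).
Proof. by rewrite -osnormN opprB. Qed.

Lemma osnorm_triangle V (x y z : V) :
  osnorm (x - z) <= osnorm (x - y) + osnorm (y - z).
Proof. by apply: le_trans (osnormD _ _); rewrite addrA subrK. Qed.

End MatrixNorms.

(** * Similarity of tuples and the linear maps it induces between spans *)

Section Similarity.
Context {R : realType}.
Implicit Types U V W : opSpaceType R.

Definition dominates V W n (K : R) (a : nat -> V) (b : nat -> W) : Prop :=
  forall k (A : nat -> 'M[R[i]]_k),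
    mxnorm (lincomb n A b) <= K * mxnorm (lincomb n A a).

(* [a_i |-> b_i] induces a well-defined map between the spans even when the *)
(* tuples are linearly dependent, since [K] bounds its cb norm.             *)
Definition similar V W n (K : R) (a : nat -> V) (b : nat -> W) : Prop :=
  dominates n K a b /\ dominates n K b a.

Lemma similar_sym V W n K (a : nat -> V) (b : nat -> W) :
  similar n K a b -> similar n K b a.
Proof. by case. Qed.

Lemma dominates_trans U V W n K L (a : nat -> U) (b : nat -> V) (c : nat -> W) :
  0 <= L -> dominates n K a b -> dominates n L b c -> dominates n (L * K) a c.
Proof.
move=> L0 ab bc k A; by rewrite (le_trans (bc k A)) // -mulrA ler_wpM2l.
Qed.

Lemma similar_trans U V W n K L (a : nat -> U) (b : nat -> V) (c : nat -> W) :
  0 <= K -> 0 <= L -> similar n K a b -> similar n L b c ->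
  similar n (L * K) a c.
Proof.
move=> K0 L0 [ab ba] [bc cb]; split; first exact: (dominates_trans L0 ab bc).
by rewrite mulrC; exact: (dominates_trans K0 cb ba).
Qed.

Lemma dominates_le V W n K L (a : nat -> V) (b : nat -> W) :
  K <= L -> dominates n K a b -> dominates n L a b.
Proof.
by move=> KL ab k A; rewrite (le_trans (ab k A)) // ler_wpM2r ?mxnorm_ge0.
Qed.

Lemma similar_le V W n K L (a : nat -> V) (b : nat -> W) :
  K <= L -> similar n K a b -> similar n L a b.
Proof. by move=> KL [ab ba]; split; exact: (dominates_le KL). Qed.

Lemma eq_dominates V W n K (a a' : nat -> V) (b b' : nat -> W) :
  (forall i, (i < n)%N -> a i = a' i) -> (forall i, (i < n)%N -> b i = b' i) ->
  dominates n K a b -> dominates n K a' b'.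
Proof.
move=> aa bb ab k A; rewrite -(eq_lincomb (fun i _ => erefl (A i)) aa).
by rewrite -(eq_lincomb (fun i _ => erefl (A i)) bb).
Qed.

Lemma eq_similar V W n K (a a' : nat -> V) (b b' : nat -> W) :
  (forall i, (i < n)%N -> a i = a' i) -> (forall i, (i < n)%N -> b i = b' i) ->
  similar n K a b -> similar n K a' b'.
Proof. by move=> aa bb [ab ba]; split; [exact: eq_dominates ab | exact: eq_dominates ba]. Qed.

Lemma dominates_substitution V W n m K (C : nat -> nat -> R[i])
    (a : nat -> V) (b : nat -> W) :
  dominates n K a b ->
  dominates m K (fun j => \sum_(i < n) C j i *: a i)
                (fun j => \sum_(i < n) C j i *: b i).
Proof. by move=> ab k A; rewrite !lincomb_substitution; exact: ab. Qed.

Lemma sum_delta (V : lmodType R[i]) n p (a : nat -> V) : (p < n)%N ->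
  \sum_(i < n) (p == i)%:R *: a i = a p.
Proof.
move=> pn; rewrite (bigD1 (Ordinal pn)) //= eqxx scale1r big1 ?addr0 // => j jp.
by case: eqP => [pj|]; rewrite ?scale0r // -(inj_eq val_inj) /= -pj eqxx in jp *.
Qed.

Lemma dominates_reindex V W n m K (f : nat -> nat) (a : nat -> V) (b : nat -> W) :
  (forall j, (j < m)%N -> (f j < n)%N) ->
  dominates n K a b -> dominates m K (a \o f) (b \o f).
Proof.
move=> fn /(dominates_substitution m (fun j i => (f j == i)%:R)).
by apply: eq_dominates => j jm; rewrite sum_delta ?fn.
Qed.

Lemma similar_reindex V W n m K (f : nat -> nat) (a : nat -> V) (b : nat -> W) :
  (forall j, (j < m)%N -> (f j < n)%N) ->
  similar n K a b -> similar m K (a \o f) (b \o f).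
Proof. by move=> fn [ab ba]; split; exact: (dominates_reindex fn). Qed.

Lemma dominates_osnorm V W n K (c : nat -> R[i]) (a : nat -> V) (b : nat -> W) :
  dominates n K a b ->
  osnorm (\sum_(i < n) c i *: b i) <= K * osnorm (\sum_(i < n) c i *: a i).
Proof. by move=> ab; rewrite !osnorm_lincomb; exact: ab. Qed.

Lemma dominates_osnorm1 V W n K i (a : nat -> V) (b : nat -> W) : (i < n)%N ->
  dominates n K a b -> osnorm (b i) <= K * osnorm (a i).
Proof.
move=> lin /(dominates_osnorm (fun j => (i == j)%:R)).
by rewrite !sum_delta.
Qed.

Lemma dominates_osnormB V W n K i j (a : nat -> V) (b : nat -> W) :
  (i < n)%N -> (j < n)%N ->
  dominates n K a b -> osnorm (b i - b j) <= K * osnorm (a i - a j).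
Proof.
move=> lin ljn /(dominates_osnorm (fun l => (i == l)%:R - (j == l)%:R)).
under eq_bigr do rewrite scalerBl; rewrite sumrB !sum_delta //.
by under eq_bigr do rewrite scalerBl; rewrite sumrB !sum_delta.
Qed.

Definition span V n (a : nat -> V) : {pred V} :=
  fun x => `[< exists c : nat -> R[i], x = \sum_(i < n) c i *: a i >].

Lemma span_submod_closed V n (a : nat -> V) :
  submod_closed (span n a).
Proof.
split=> [|c x y /asboolP[u ->] /asboolP[v ->]].
  by apply/asboolP; exists (fun=> 0); rewrite big1 // => i _; rewrite scale0r.
apply/asboolP; exists (fun i => c * u i + v i).
rewrite scaler_sumr -big_split /=; apply: eq_bigr => i _.
by rewrite scalerDl scalerA.
Qed.

HB.instance Definition _ (V : opSpaceType R) n (a : nat -> V) :=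
  GRing.isSubmodClosed.Build R[i] V (span n a)
    (GRing.submod_closed_semi (span_submod_closed n a)).

Lemma mem_span V n (a : nat -> V) i : (i < n)%N -> a i \in span n a.
Proof.
by move=> lin; apply/asboolP; exists (fun j => (i == j)%:R); rewrite sum_delta.
Qed.

Lemma mxnorm_map_val V (E : submodClosed V) k (x : 'M[subspace E]_k) :
  mxnorm x = mxnorm (map_mx val x).
Proof. by []. Qed.

Definition spans V (E : {pred V}) n (a : nat -> V) : Prop :=
  (forall i, (i < n)%N -> a i \in E) /\
  forall x, x \in E -> exists c : nat -> R[i], x = \sum_(i < n) c i *: a i.

Lemma spans_span V n (a : nat -> V) : spans (span n a) n a.
Proof. by split=> [i|x /asboolP//]; exact: mem_span. Qed.

(** Domination sends every linear relation among the [a i] to a relation among the [b i], so the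
    value computed from arbitrarily chosen coefficients does not depend on them; this also gives
    linearity. *)
Lemma dominates_linear V W n K (a : nat -> V) (b : nat -> W)
    (E : submodClosed V) (F : submodClosed W) :
  spans E n a -> spans F n b -> dominates n K a b ->
  exists f : {linear subspace E -> subspace F},
    (forall (c : nat -> R[i]) x, val x = \sum_(i < n) c i *: a i ->
      val (f x) = \sum_(i < n) c i *: b i) /\
    forall k (x : 'M_k), mxnorm (map_mx f x) <= K * mxnorm x.
Proof.
move=> [aE aS] [bF bS] ab.
have [C HC] := choice (fun x : subspace E => aS (val x) (valP x)).
have inF x : \sum_(i < n) C x i *: b i \in F.
  by apply: rpred_sum => i _; apply: rpredZ; exact: bF.
pose f x : subspace F := exist (fun y => y \in F) _ (inF x).
have fE (c : nat -> R[i]) x : val x = \sum_(i < n) c i *: a i ->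
    val (f x) = \sum_(i < n) c i *: b i.
  move=> xc; apply/eqP; rewrite -subr_eq0 -sumrB; apply/eqP/osnorm_eq0.
  under eq_bigr do rewrite -scalerBl.
  apply/eqP; rewrite eq_le osnorm_ge0 andbT.
  rewrite (le_trans (dominates_osnorm (fun i => C x i - c i) ab)) //.
  under eq_bigr do rewrite scalerBl.
  by rewrite sumrB -HC -xc subrr osnorm0 mulr0.
have lin : linear f.
  move=> c x y; apply: val_inj; rewrite (fE (fun i => c * C x i + C y i)) /=.
    rewrite scaler_sumr -big_split; apply: eq_bigr => i _ /=.
    by rewrite scalerDl scalerA.
  rewrite (HC x) (HC y) scaler_sumr -big_split; apply: eq_bigr => i _ /=.
  by rewrite scalerDl scalerA.
pose g : {linear subspace E -> subspace F} :=
  HB.pack f (GRing.isLinear.Build R[i] (subspace E) (subspace F) _ f lin).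
exists g; split=> // k x.
pose A i : 'M[R[i]]_k := \matrix_(r, s) C (x r s) i.
have -> : mxnorm (map_mx g x) = mxnorm (lincomb n A b).
  rewrite mxnorm_map_val; congr mxnorm; apply/matrixP => r s; rewrite !mxE.
  by apply: eq_bigr => i _; rewrite mxE.
have -> : mxnorm x = mxnorm (lincomb n A a).
  rewrite mxnorm_map_val; congr mxnorm; apply/matrixP => r s; rewrite !mxE HC.
  by apply: eq_bigr => i _; rewrite mxE.
exact: ab.
Qed.

Lemma similar_linIso V W n K (a : nat -> V) (b : nat -> W)
    (E : submodClosed V) (F : submodClosed W) :
  spans E n a -> spans F n b -> similar n K a b ->
  exists f : linIso (subspace E) (subspace F),
    [/\ (forall i x, (i < n)%N -> val x = a i -> val (f x) = b i),
        (forall k (x : 'M_k), mxnorm (map_mx f x) <= K * mxnorm x) &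
        forall k (x : 'M_k), mxnorm (map_mx (iso_inv f) x) <= K * mxnorm x].
Proof.
move=> aE bF [/(dominates_linear aE bF)[f [fE fK]] /(dominates_linear bF aE)[g [gE gK]]].
have fgK : cancel f g.
  move=> x; apply: val_inj; have [c xc] := aE.2 _ (valP x).
  by rewrite (gE c) ?(fE c).
have gfK : cancel g f.
  move=> x; apply: val_inj; have [c xc] := bF.2 _ (valP x).
  by rewrite (fE c) ?(gE c).
exists (LinIso fgK gfK); split=> //= i x lin xi.
by rewrite (fE (fun j => (i == j)%:R)) sum_delta.
Qed.

End Similarity.

(** * Distortion of isomorphisms, and 1-exactness in terms of tuples *)

Section Distortion.
Context {R : realType}.
Implicit Types U V W : opSpaceType R.

Lemma cbnorm_ge0 V W (u : {linear V -> W}) : (0 <= cbnorm u)%E.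
Proof.
apply: ereal_sup_ge; exists (ampnorm u 0); first by exists 0%N.
apply: ereal_sup_ge; exists (mxnorm (map_mx u (0 : 'M[V]_0)))%:E.
  by exists 0 => //=; rewrite mxnorm0.
by rewrite lee_fin mxnorm_ge0.
Qed.

Lemma cbnorm_le V W (u : {linear V -> W}) (K : R) : 0 <= K ->
  (forall k (x : 'M_k), mxnorm (map_mx u x) <= K * mxnorm x) ->
  (cbnorm u <= K%:E)%E.
Proof.
move=> K0 uK; apply: ge_ereal_sup => _ [k _ <-].
apply: ge_ereal_sup => _ [x /= x1 <-]; rewrite lee_fin (le_trans (uK _ _)) //.
by rewrite ler_piMr.
Qed.

Lemma cbnorm_bound V W (u : {linear V -> W}) (K : R) : (cbnorm u <= K%:E)%E ->
  forall k (x : 'M_k), mxnorm (map_mx u x) <= K * mxnorm x.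
Proof.
move=> uK k x; have [/mxnorm_eq0->|x0] := eqVneq (mxnorm x) 0.
  have -> : map_mx u 0 = 0 :> 'M_k by apply/matrixP => r s; rewrite !mxE linear0.
  by rewrite !mxnorm0 mulr0.
have xp : 0 < mxnorm x by rewrite lt_def x0 mxnorm_ge0.
have cV : cnorm ((mxnorm x)^-1)%:C = (mxnorm x)^-1.
  by rewrite cnorm_real ger0_norm // invr_ge0 mxnorm_ge0.
rewrite -ler_pdivrMr // mulrC -cV -mxnormZ -lee_fin; apply: le_trans uK.
apply: le_ereal_sup_tmp; exists (ampnorm u k); first by exists k.
apply: ereal_sup_ubound.
exists (map_mx ( *:%R ((mxnorm x)^-1)%:C) x) => /=.
  by rewrite mxnormZ cV mulVf.
by congr (mxnorm _)%:E; apply/matrixP => r s; rewrite !mxE linearZ.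
Qed.

Lemma distortion_le V W (f : linIso V W) (K : R) : 1 <= K ->
  (forall k (x : 'M_k), mxnorm (map_mx f x) <= K * mxnorm x) ->
  (forall k (x : 'M_k), mxnorm (map_mx (iso_inv f) x) <= K * mxnorm x) ->
  cb_isomorphism f /\ (distortion f <= (K * K)%:E)%E.
Proof.
move=> K1 fK gK; have K0 : 0 <= K by rewrite (le_trans ler01).
have fc := cbnorm_le K0 fK; have gc := cbnorm_le K0 gK.
split; first by split; [exact: le_lt_trans fc (ltry _) | exact: le_lt_trans gc (ltry _)].
rewrite /distortion; case: ifP => _; first by rewrite lee_fin mulr_ege1.
by rewrite EFinM lee_pmul ?cbnorm_ge0.
Qed.

Lemma cbnorm_gt0 V W (u : {linear V -> W}) x : u x != 0 -> (0 < cbnorm u)%E.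
Proof.
move=> ux; rewrite lt_def cbnorm_ge0 andbT; apply: contra_neq ux => u0.
have := @cbnorm_bound _ _ u 0; rewrite u0 lexx => /(_ erefl _ (const_mx x : 'M_1)).
rewrite mul0r map_const_mx => ux0; apply: osnorm_eq0.
by apply/eqP; rewrite eq_le osnorm_ge0 andbT.
Qed.

(** The distortion bounds only a product of norms, so the two-sided estimate holds up to a scale:
    outside the zero case, [l] is the inverse of the cb norm of [f]. *)
Lemma distortion_lt V W (f : linIso V W) (K : R) : 1 <= K ->
  (distortion f < K%:E)%E -> exists2 l : R, 0 < l &
  forall k (x : 'M_k),
    l * mxnorm (map_mx f x) <= mxnorm x <= K * (l * mxnorm (map_mx f x)).
Proof.
move=> K1; rewrite /distortion; case: asboolP => [V0 _|/existsNP[x x0]].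
  exists 1 => // k x; have -> : x = 0 by apply/matrixP => r s; rewrite mxE; exact: V0.
  have -> : map_mx f 0 = 0 :> 'M_k by apply/matrixP => r s; rewrite !mxE linear0.
  by rewrite !mxnorm0 !mulr0 lexx.
have f0 : (0 < cbnorm f)%E.
  apply: (@cbnorm_gt0 _ _ _ x); apply/eqP => fx; apply: x0.
  by rewrite -(iso_funK f x) fx linear0.
have g0 : (0 < cbnorm (iso_inv f))%E.
  by apply: (@cbnorm_gt0 _ _ _ (f x)); rewrite iso_funK; apply/eqP.
move: (@cbnorm_bound _ _ f) (@cbnorm_bound _ _ (iso_inv f)) f0 g0.
(* Both cb norms are positive, so an infinite one would make the product infinite, against the bound
   [K]. *)
case: (cbnorm f) => [p||]; case: (cbnorm (iso_inv f)) => [q||] //;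
  rewrite ?lte_fin; try by move=> _ _ p0 q0; rewrite ?mulyy ?gt0_muley ?gt0_mulye.
move=> fp gq p0 q0 pqK.
exists p^-1 => [|k y]; first by rewrite invr_gt0.
apply/andP; split.
  by rewrite ler_pdivrMl // fp // lexx.
rewrite mulrA.
have := gq _ (lexx _) _ (map_mx f y).
have -> : map_mx (iso_inv f) (map_mx f y) = y.
  by apply/matrixP => r s; rewrite !mxE iso_funK.
move=> yq; rewrite (le_trans yq) // ler_wpM2r ?mxnorm_ge0 //.
by rewrite ler_pdivlMr // mulrC ltW.
Qed.

Lemma similar_of_bounds V W (f : {linear V -> W}) (l K : R) n (a : nat -> V) :
  0 < l -> 1 <= K ->
  (forall k (x : 'M_k),
    l * mxnorm (map_mx f x) <= mxnorm x <= K * (l * mxnorm (map_mx f x))) ->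
  similar n K a (fun i => l%:C *: f (a i)).
Proof.
move=> l0 K1 fK; split=> k A; rewrite lincombZ -(map_lincomb f) mxnormZ
  cnorm_real gtr0_norm //; have /andP[le1 le2] := fK k (lincomb n A a); last by [].
by rewrite (le_trans le1) // ler_peMl ?mxnorm_ge0.
Qed.

(** This is 1-exactness for tuples; the equivalence is [locally_matricial_exact] with
    [exact_locally_matricial]. *)
Definition locally_matricial V : Prop := forall n (a : nat -> V) (K : R),
  1 < K -> exists p (alpha : nat -> 'M[R[i]]_p), similar n K a alpha.

Lemma similar_refl V n (K : R) (a : nat -> V) : 1 <= K -> similar n K a a.
Proof. by move=> K1; split=> k A; rewrite ler_peMl ?mxnorm_ge0. Qed.

Lemma locally_matricial_matrix p : locally_matricial 'M[R[i]]_p.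
Proof. by move=> n a K /ltW K1; exists p, a; exact: similar_refl. Qed.

Lemma similar_val V (E : submodClosed V) n (K : R) (a : nat -> subspace E) :
  1 <= K -> similar n K a (val \o a).
Proof.
move=> K1; split=> k A; rewrite (mxnorm_map_val (lincomb n A a)) map_lincomb;
  by rewrite ler_peMl ?mxnorm_ge0.
Qed.

Lemma locally_matricial_subspace V (E : submodClosed V) :
  locally_matricial V -> locally_matricial (subspace E).
Proof.
move=> VM n a K K1; have [p [al aal]] := VM n (val \o a) K K1.
exists p, al; rewrite -(mulr1 K); have K0 := le_trans ler01 (ltW K1).
exact: similar_trans (similar_val _ _ (lexx _)) aal.
Qed.

Lemma finite_dimensional_spans V (E : submodClosed V) :
  finite_dimensional (subspace E) -> exists n (a : nat -> V), spans E n a.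
Proof.
move=> [n [b bS]].
pose a i := if insub i is Some j then val (b j) else 0.
have aE (j : 'I_n) : a j = val (b j) by rewrite /a valK.
exists n, a; split=> [i lin|x xE].
  by have /= -> := aE (Ordinal lin); exact: valP.
have [c] := bS (exist (fun y => y \in E) x xE).
move=> /(congr1 val); rewrite raddf_sum /= => ->.
exists (fun i => if insub i is Some j then c j else 0).
by apply: eq_bigr => j _; rewrite aE valK.
Qed.

Lemma spans_finite_dimensional V (E : submodClosed V) n (a : nat -> V) :
  spans E n a -> finite_dimensional (subspace E).
Proof.
move=> [aE aS]; exists n, (fun i : 'I_n => exist (fun y => y \in E) (a i) (aE i (ltn_ord i))).
move=> x; have [c xc] := aS _ (valP x); exists (fun i => c i).
by apply: val_inj; rewrite xc raddf_sum; apply: eq_bigr => i _ /=.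
Qed.

Lemma exists_sqr_lt (K : R) : 1 < K -> exists2 L, 1 < L & L * L < K.
Proof.
move=> K1; exists (Num.min 2 ((K + 3) / 4)).
  by rewrite lt_min; apply/andP; split; lra.
by case: (leP 2 ((K + 3) / 4)) => ?; nra.
Qed.

Lemma locally_matricial_exact V : locally_matricial V -> is_exact V 1.
Proof.
move=> VM E /finite_dimensional_spans[n [a aE]] e e0.
have [K K1 KK] : exists2 K, 1 < K & K * K < 1 + e by apply: exists_sqr_lt; lra.
have [p [al aal]] := VM n a K K1.
exists p, (span n al : submodClosed 'M[R[i]]_p).
have [f [_ fK gK]] := similar_linIso aE (spans_span n al) aal.
have [fcb fd] := distortion_le (ltW K1) fK gK.
apply: (@le_lt_trans _ _ (K * K)%:E); last by rewrite lte_fin.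
by apply: le_trans fd; apply: ereal_inf_lbound; exists f.
Qed.

Lemma exact_locally_matricial V : is_exact V 1 -> locally_matricial V.
Proof.
move=> Vex n a K K1.
have e0 : 0 < K - 1 by lra.
have [p [F dF]] := Vex (span n a) (spans_finite_dimensional (spans_span n a)) _ e0.
rewrite addrC subrK in dF.
have [_ [f _ <-] fK] := ereal_inf_lt dF.
have [l l0 fl] := distortion_lt (ltW K1) fK.
pose b i : subspace (span n a) := insubd 0 (a i).
have bE i : (i < n)%N -> val (b i) = a i.
  by move=> lin; rewrite insubdK ?mem_span.
exists p, (val \o (fun i => l%:C *: f (b i))).
have K0 : 0 <= K by rewrite (le_trans ler01) // ltW.
have ab : similar n 1 a b.
  exact: (eq_similar bE (fun _ _ => erefl) (similar_sym (similar_val n b (lexx 1)))).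
have bf := similar_of_bounds n b l0 (ltW K1) fl.
have af := similar_trans ler01 K0 ab bf; rewrite mulr1 in af.
by have := similar_trans K0 ler01 af (similar_val _ _ (lexx 1)); rewrite mul1r.
Qed.

End Distortion.

(** * The Gurariy extension property for tuples *)

Section TupleExtension.
Context {R : realType}.
Implicit Types U V W : opSpaceType R.

(** The cube accounts for the conversion from distortion: a map with both norms at most [K] has
    distortion at most [K ^+ 2], and fixing the scale of its extension costs one more factor [K]. *)
Definition tuple_extension W : Prop :=
  forall (V : opSpaceType R) m n (a : nat -> V) (b : nat -> W) (K L : R),
  locally_matricial V -> (n <= m)%N -> 1 <= K -> K ^+ 3 < L ->
  similar n K a b ->
  exists2 b' : nat -> W,
    forall i, (i < n)%N -> b' i = b i & similar m L a b'.

Lemma extension_property_tuple W : extension_property W -> tuple_extension W.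
Proof.
move=> extW V m n a b K L VM nm K1 KL ab.
have K0 : 0 < K by rewrite (lt_le_trans ltr01).
have K3 : 0 < K ^+ 3 by rewrite exprn_gt0.
pose E0 : submodClosed V := span m a.
pose a' i : subspace E0 := insubd 0 (a i).
have aE i : (i < m)%N -> val (a' i) = a i.
  by move=> lim; rewrite insubdK //; exact: mem_span.
have aa' : similar m 1 a a'.
  exact: (eq_similar aE (fun _ _ => erefl) (similar_sym (similar_val m a' (lexx 1)))).
have a'b : similar n K a' b.
  have := similar_trans ler01 (ltW K0) (similar_sym (similar_reindex (f := id) _ aa')) ab.
  by rewrite mulr1; apply=> j jn; exact: leq_trans nm.
have [u [uE uK vK]] := similar_linIso (spans_span n a') (spans_span n b) a'b.
have [ucb ud] := distortion_le K1 uK vK.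
pose delta := L / K ^+ 3 - 1.
have d0 : 0 < delta by rewrite subr_gt0 ltr_pdivlMr ?mul1r.
pose D := (1 + delta) * (K * K).
have KD : K * D = L.
  by rewrite /D /delta addrC subrK; field; rewrite gt_eqF.
have D1 : 1 <= D.
  have KK : 1 <= K * K by rewrite mulr_ege1.
  by rewrite /D mulr_ege1 //; lra.
have D0 : 0 < D by rewrite (lt_le_trans ltr01).
have DL : D <= L by rewrite -KD ler_peMl // ltW.
have Ffd : finite_dimensional (subspace E0).
  exact: spans_finite_dimensional (spans_span m a).
have Fex := locally_matricial_exact (locally_matricial_subspace (E := E0) VM).
have [F' [u' [_ u'E u'd]]] := extW _ Ffd Fex _ _ u ucb _ d0.
have u'D : (distortion u' < D%:E)%E.
  apply: lt_le_trans u'd _; rewrite /D EFinM lee_wpmul2l // lee_fin.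
  by rewrite addr_ge0 // ltW.
have {}u'E i : (i < n)%N -> val (u' (a' i)) = b i.
  move=> lin; pose x : subspace (span n a') := exist (fun y => y \in span n a') _ (mem_span a' lin).
  by rewrite -[a' i]/(val x) u'E (uE i).
have [l l0 lD] := distortion_lt D1 u'D.
pose c i : W := val (u' (a' i)).
have cE k (A : nat -> 'M[R[i]]_k) : l * mxnorm (lincomb m A c)
    <= mxnorm (lincomb m A a) <= D * (l * mxnorm (lincomb m A c)).
  have := lD k (lincomb m A a'); rewrite map_lincomb !mxnorm_map_val !map_lincomb.
  by rewrite (eq_lincomb (b := a) (fun i _ => erefl (A i)) aE).
(* The extension is controlled only up to the scale [l]. A nonzero [a i0], whose image is the
   prescribed [b i0], forces [l <= K] and [1 <= L * l]. *)
clearbody D; have [[i0 i0n ai0]|a0] := pselect (exists2 i, (i < n)%N & a i != 0).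
  have bi0 : 0 < osnorm (b i0).
    rewrite lt_def osnorm_ge0 andbT; apply: contra_neq ai0 => bi0.
    apply: osnorm_eq0; apply/eqP; rewrite eq_le osnorm_ge0 andbT.
    by have := dominates_osnorm1 i0n ab.2; rewrite bi0 mulr0.
  have := lD _ (const_mx (a' i0) : 'M_1).
  have -> : mxnorm (map_mx u' (const_mx (a' i0) : 'M_1)) = osnorm (b i0).
    by rewrite map_const_mx mxnorm_map_val map_const_mx u'E.
  have -> : mxnorm (const_mx (a' i0) : 'M_1) = osnorm (a i0).
    by rewrite mxnorm_map_val map_const_mx aE // (leq_trans i0n).
  have ab1 := dominates_osnorm1 i0n ab.1.
  have ab2 := dominates_osnorm1 i0n ab.2.
  move=> /andP[le1 le2].
  have lK : l <= K by rewrite -(ler_pM2r bi0) (le_trans le1).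
  have Kl : 1 <= L * l.
    rewrite -(ler_pM2r bi0) mul1r -KD (le_trans ab1) // -!mulrA.
    by rewrite ler_pM2l.
  exists c => //; split=> k A; have /andP[c1 c2] := cE k A.
    rewrite -(ler_pM2l l0) (le_trans c1) // mulrCA mulrA.
    by rewrite ler_peMl ?mxnorm_ge0.
  rewrite (le_trans c2) // -KD [K * D]mulrC -mulrA ler_pM2l //.
  by rewrite ler_wpM2r ?mxnorm_ge0.
(* If all prescribed vectors vanish, rescaling the extension by [l] keeps their images. *)
have az i : (i < n)%N -> b i = l%:C *: c i.
  move=> lin; have ai0 : a i = 0 by apply/eqP; apply: contrapT => /negP ai; apply: a0; exists i.
  have bi0 : b i = 0.
    apply: osnorm_eq0; apply/eqP; rewrite eq_le osnorm_ge0 andbT.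
    by have := dominates_osnorm1 lin ab.1; rewrite ai0 osnorm0 mulr0.
  by rewrite /c u'E // bi0 scaler0.
exists (fun i => l%:C *: c i) => [i /az->//|].
apply: similar_le DL _; split=> k A; rewrite lincombZ mxnormZ cnorm_real gtr0_norm //;
  have /andP[c1 c2] := cE k A; last by [].
by rewrite (le_trans c1) // ler_peMl ?mxnorm_ge0.
Qed.

End TupleExtension.

(** * Norms of block diagonal tuples in [M_(p+q)] *)

Section BlockDiagonal.
Context {R : realType}.

Lemma l2sq_col_mx p q (u : 'cV[R[i]]_p) (v : 'cV[R[i]]_q) :
  l2sq (col_mx u v) = l2sq u + l2sq v.
Proof.
rewrite /l2sq big_split_ord; congr (_ + _); apply: eq_bigr => i _.
  by rewrite col_mxEu.
by rewrite col_mxEd.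
Qed.

Lemma l2sq_mulmx_le m n (A : 'M[R[i]]_(m, n)) v c : mxopnorm A <= c ->
  l2sq (A *m v) <= c ^+ 2 * l2sq v.
Proof.
move=> Ac; have c0 : 0 <= c by rewrite (le_trans (mxopnorm_ge0 A)).
rewrite -!l2normK -exprMn ler_sqr ?nnegrE ?mulr_ge0 ?l2norm_ge0 //.
by rewrite (le_trans (mxopnorm_ub _ _)) // ler_wpM2r ?l2norm_ge0.
Qed.

Lemma mxopnorm_le_l2sq m n (A : 'M[R[i]]_(m, n)) c : 0 <= c ->
  (forall v, l2sq (A *m v) <= c ^+ 2 * l2sq v) -> mxopnorm A <= c.
Proof.
move=> c0 Ac; apply: mxopnorm_le => // v.
by rewrite l2norm_le ?mulr_ge0 ?l2norm_ge0 // exprMn l2normK.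
Qed.

Definition diag_block p q k (x : 'M['M[R[i]]_p]_k) (y : 'M['M[R[i]]_q]_k) :
    'M['M[R[i]]_(p + q)]_k :=
  \matrix_(r, s) block_mx (x r s) 0 0 (y r s).

(** Up to a permutation of coordinates the matrix is the direct sum of [X] and [Y]. Instead of
    permuting, each vector is cut into its [p]- and [q]-parts, on which [X] and [Y] act separately,
    and squared lengths add. *)
Lemma mxnorm_diag_block p q k (x : 'M['M[R[i]]_p]_k) (y : 'M['M[R[i]]_q]_k) :
  mxnorm (diag_block x y) = Num.max (mxnorm x) (mxnorm y).
Proof.
pose X := \mxblock_(i < k, j < k) x i j.
pose Y := \mxblock_(i < k, j < k) y i j.
pose Z := \mxblock_(i < k, j < k) diag_block x y i j.
have ZE (u : 'I_k -> 'cV_p) (v : 'I_k -> 'cV_q) :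
    l2sq (Z *m \mxcol_j col_mx (u j) (v j))
    = l2sq (X *m \mxcol_j u j) + l2sq (Y *m \mxcol_j v j).
  rewrite !mul_mxblock_mxrow !l2sq_mxcol -big_split /=; apply: eq_bigr => i _.
  rewrite -l2sq_col_mx; congr l2sq.
  transitivity (\sum_j col_mx (x i j *m u j) (y i j *m v j)).
    apply: eq_bigr => j _; rewrite mxE mul_block_col !mul0mx addr0 add0r //.
  by elim/big_rec3: _ => [|j a b c _ ->]; rewrite ?col_mx0 ?add_col_mx.
have uvE (u : 'I_k -> 'cV[R[i]]_p) (v : 'I_k -> 'cV[R[i]]_q) :
    l2sq (\mxcol_j col_mx (u j) (v j)) = l2sq (\mxcol_j u j) + l2sq (\mxcol_j v j).
  rewrite !l2sq_mxcol -big_split /=; apply: eq_bigr => i _.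
  exact: l2sq_col_mx.
have l2sq0 m : l2sq (0 : 'cV[R[i]]_m) = 0 by rewrite -l2normK l2norm0 expr0n.
apply/eqP; rewrite eq_le ge_max; apply/and3P; split.
- apply: mxopnorm_le_l2sq => [|v]; first by rewrite le_max mxopnorm_ge0.
  have -> : v = \mxcol_j col_mx (usubmx (submxcol v j)) (dsubmx (submxcol v j)).
    by rewrite -[LHS]submxcolK; apply: eq_mxcol => j; rewrite vsubmxK.
  rewrite ZE uvE mulrDr.
  by apply: lerD; apply: l2sq_mulmx_le; rewrite le_max lexx ?orbT.
- apply: mxopnorm_le_l2sq => [|v]; first exact: mxopnorm_ge0.
  have := l2sq_mulmx_le (\mxcol_j col_mx (submxcol v j) 0) (lexx (mxopnorm Z)).
  by rewrite ZE uvE submxcolK mxcol0 mulmx0 !l2sq0 !addr0.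
- apply: mxopnorm_le_l2sq => [|v]; first exact: mxopnorm_ge0.
  have := l2sq_mulmx_le (\mxcol_j col_mx 0 (submxcol v j)) (lexx (mxopnorm Z)).
  by rewrite ZE uvE submxcolK mxcol0 mulmx0 !l2sq0 !add0r.
Qed.

Lemma lincomb_diag_block p q k n (A : nat -> 'M[R[i]]_k)
    (a : nat -> 'M[R[i]]_p) (b : nat -> 'M[R[i]]_q) :
  lincomb n A (fun i => block_mx (a i) 0 0 (b i))
  = diag_block (lincomb n A a) (lincomb n A b).
Proof.
apply/matrixP => r s; rewrite !mxE.
elim/big_rec3: _ => [|i x y z _ ->]; first by rewrite block_mx0.
by rewrite scale_block_mx !scaler0 add_block_mx !addr0.
Qed.

End BlockDiagonal.

(** * Transport of both properties along [d_cb = 1] *)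

Section NearIsometry.
Context {R : realType}.
Implicit Types V W : opSpaceType R.

(** The infimum in [d_cb] need not be attained, so each [K] has its own map and its own scale
    [l]. *)
Definition nearly_isometric V W : Prop := forall K : R, 1 < K ->
  exists (f : linIso V W) (l : R), 0 < l /\ forall k (x : 'M_k),
    l * mxnorm (map_mx f x) <= mxnorm x <= K * (l * mxnorm (map_mx f x)).

Lemma d_cb1_nearly_isometric V W : d_cb V W = 1%E -> nearly_isometric V W.
Proof.
move=> d1 K K1; have : (d_cb V W < K%:E)%E by rewrite d1 lte_fin.
move=> /ereal_inf_lt[_ [f _ <-]] /(distortion_lt (ltW K1))[l l0 fl].
by exists f, l.
Qed.

Lemma nearly_isometric_matricial V W :
  nearly_isometric V W -> locally_matricial W -> locally_matricial V.
Proof.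
move=> VW WM n a K /exists_sqr_lt[J J1 JK].
have [f [l [l0 fl]]] := VW _ J1.
have [p [al aal]] := WM n (fun i => l%:C *: f (a i)) J J1.
exists p, al; have J0 := le_trans ler01 (ltW J1).
apply: (similar_le (ltW JK)).
exact: (similar_trans J0 J0 (similar_of_bounds n a l0 (ltW J1) fl) aal).
Qed.

(** Push [b] into [W] by the rescaled map, extend there, and pull the result back; on the first [n]
    entries the two passages cancel exactly. *)
Lemma nearly_isometric_tuple_extension V W :
  nearly_isometric V W -> tuple_extension W -> tuple_extension V.
Proof.
move=> VW WQ U m n a b K L UM nm K1 KL ab.
have K0 : 0 < K by rewrite (lt_le_trans ltr01).
have K3 : 0 < K ^+ 3 by rewrite exprn_gt0.
(* Here [J ^+ 4 * K ^+ 3 < L]: three factors [J] come from cubing [J * K], the fourth from pulling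
   back. *)
have /exists_sqr_lt[J2 /exists_sqr_lt[J J1 JJ] J2L] : 1 < L / K ^+ 3.
  by rewrite ltr_pdivlMr ?mul1r.
have J0 : 0 < J by rewrite (lt_trans ltr01).
have [f [l [l0 fl]]] := VW _ J1.
have [|||b1 b1E ab1] := WQ U m n a (fun i => l%:C *: f (b i)) (J * K) (L / J) UM nm.
- by rewrite mulr_ege1 // ltW.
- rewrite ltr_pdivlMr // exprMn.
  move: J2L; rewrite ltr_pdivlMr //; apply: le_lt_trans.
  rewrite mulrAC ler_pM2r // -exprSr.
  have -> : J ^+ 4 = (J * J) * (J * J) by ring.
  by rewrite ler_pM ?mulr_ge0 ?ltW.
- exact: (similar_trans (ltW K0) (ltW J0) ab (similar_of_bounds n b l0 (ltW J1) fl)).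
pose b' i := iso_inv f (l%:C^-1 *: b1 i).
have lC0 : l%:C != 0 :> R[i] by rewrite fmorph_eq0 gt_eqF.
have fb' i : l%:C *: f (b' i) = b1 i.
  by rewrite iso_invK scalerA mulfV // scale1r.
exists b' => [i lin|].
  by rewrite /b' b1E // scalerA mulVf // scale1r iso_funK.
have LJ0 : 0 <= L / J.
  by rewrite divr_ge0 ?(ltW J0) // (le_trans _ (ltW KL)) // ltW.
have -> : L = J * (L / J) by field; rewrite gt_eqF.
apply: (similar_trans LJ0 (ltW J0) ab1).
apply: similar_sym; have := similar_of_bounds m b' l0 (ltW J1) fl.
by apply: eq_similar => // i _.
Qed.

End NearIsometry.

(** * Trading distortion for a small displacement *)

Section Correction.
Context {R : realType}.
Implicit Types V W : opSpaceType R.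

Lemma exists_exp_lt n (M : R) : 1 < M -> exists2 K, 1 < K & K ^+ n < M.
Proof.
elim: n M => [|n IH] M M1; first by exists M => //; rewrite expr0.
have [L L1 LL] := exists_sqr_lt M1; have [K K1 KL] := IH L L1.
have m1 : 1 < Num.min K L by rewrite lt_min K1.
have m0 : 0 <= Num.min K L by rewrite (le_trans ler01) // ltW.
exists (Num.min K L) => //; apply: le_lt_trans LL; rewrite exprS.
rewrite ler_pM ?exprn_ge0 ?ge_min ?lexx ?orbT //; apply: le_trans (ltW KL).
by rewrite lerXn2r ?nnegrE ?ge_min ?lexx // (le_trans ler01) // ltW.
Qed.

Lemma lincomb_scaled_norm V k n (A : nat -> 'M[R[i]]_k) (s : R) (a : nat -> V) :
  0 <= s ->
  mxnorm (lincomb n A (fun i => s%:C *: a i)) = s * mxnorm (lincomb n A a).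
Proof. by move=> s0; rewrite lincombZ mxnormZ cnorm_real ger0_norm. Qed.

(* [g] and [h] are copies of [a] and [b] in a common matrix algebra at      *)
(* distance [O(delta)], obtained by shrinking the redundant coordinate by   *)
(* [s = (1 + delta)^-2].                                                    *)
Lemma amalgamate V W n (a : nat -> V) (b : nat -> W) (K delta : R) :
  locally_matricial V -> locally_matricial W ->
  1 < K -> K * K <= 1 + delta -> 0 < delta ->
  similar n (1 + delta) a b ->
  exists p (g h : nat -> 'M[R[i]]_p),
    [/\ similar n K a g, similar n K h b &
        forall i, (i < n)%N ->
          osnorm (g i - h i) <= 2 * K * delta * (1 + delta) * osnorm (a i)].
Proof.
move=> VM WM K1 KKd d0 ab.
have K0 : 0 <= K by rewrite (le_trans ler01) // ltW.
have d1 : 0 < 1 + delta by rewrite addr_gt0.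
have [p [al aal]] := VM n a K K1; have [q [be bbe]] := WM n b K K1.
pose s := ((1 + delta) ^+ 2)^-1.
have s0 : 0 < s by rewrite invr_gt0 exprn_gt0.
have s1 : s <= 1 by rewrite invf_le1 ?exprn_gt0 // exprn_ege1 // lerDl ltW.
have s2 : 1 - s <= 2 * delta.
  rewrite lerBlDl -lerBlDr /s -[leRHS]div1r ler_pdivlMr ?exprn_gt0 //.
  nra.
have alK : similar n ((1 + delta) ^+ 2) al be.
  have := similar_trans (mulr_ge0 (ltW d1) K0) K0
    (similar_trans K0 (ltW d1) (similar_sym aal) ab) bbe.
  apply: similar_le; rewrite mulrCA expr2; nra.
pose g i : 'M[R[i]]_(p + q) := block_mx (al i) 0 0 (s%:C *: be i).
pose h i : 'M[R[i]]_(p + q) := block_mx (s%:C *: al i) 0 0 (be i).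
(* The tuples [al] and [be] are similar with constant [s^-1], so the shrunken block never exceeds
   the other one in norm. *)
have gE k (A : nat -> 'M[R[i]]_k) : mxnorm (lincomb n A g) = mxnorm (lincomb n A al).
  rewrite lincomb_diag_block mxnorm_diag_block; apply/max_idPl.
  by rewrite lincomb_scaled_norm ?(ltW s0) // ler_pdivrMl ?exprn_gt0 // alK.1.
have hE k (A : nat -> 'M[R[i]]_k) : mxnorm (lincomb n A h) = mxnorm (lincomb n A be).
  rewrite lincomb_diag_block mxnorm_diag_block; apply/max_idPr.
  by rewrite lincomb_scaled_norm ?(ltW s0) // ler_pdivrMl ?exprn_gt0 // alK.2.
exists (p + q)%N, g, h; split.
- by split=> k A; rewrite gE; [exact: aal.1|exact: aal.2].
- by split=> k A; rewrite hE; [exact: bbe.2|exact: bbe.1].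
move=> i lin.
have -> : g i - h i = block_mx ((1 - s)%:C *: al i) 0 0 (- (1 - s)%:C *: be i).
  rewrite /g /h opp_block_mx add_block_mx !subr0 rmorphB rmorph1 !scalerBl.
  by rewrite opprB scale1r !scalerBl scale1r.
have -> : osnorm (block_mx ((1 - s)%:C *: al i) 0 0 (- (1 - s)%:C *: be i))
    = Num.max (osnorm ((1 - s)%:C *: al i)) (osnorm (- (1 - s)%:C *: be i)).
  rewrite /osnorm -mxnorm_diag_block; congr mxnorm.
  by apply/matrixP => r t; rewrite !mxE.
have a1 : osnorm (al i) <= K * (1 + delta) * osnorm (a i).
  rewrite (le_trans (dominates_osnorm1 lin aal.1)) // ler_wpM2r ?osnorm_ge0 //.
  by rewrite ler_peMr // lerDl ltW.
have b1 : osnorm (be i) <= K * (1 + delta) * osnorm (a i).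
  rewrite (le_trans (dominates_osnorm1 lin bbe.1)) // -mulrA ler_wpM2l //.
  exact: dominates_osnorm1 lin ab.1.
have s3 : 0 <= 1 - s by rewrite subr_ge0.
rewrite scaleNr osnormN !osnormZ !cnorm_real ger0_norm //.
have bound x : x <= K * (1 + delta) * osnorm (a i) -> 0 <= x ->
    (1 - s) * x <= 2 * K * delta * (1 + delta) * osnorm (a i).
  have -> : 2 * K * delta * (1 + delta) * osnorm (a i)
      = (2 * delta) * (K * (1 + delta) * osnorm (a i)) by ring.
  by move=> xK x0; rewrite ler_pM.
by rewrite ge_max !bound ?osnorm_ge0.
Qed.

(** Two extensions are made: one out of a matrix algebra replaces [b] by a nearby, almost exact copy
    [d] of [a]; the other, starting from [a |-> d], adds an image for the new vector [a n]. *)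
Lemma correct_and_extend V W n (a : nat -> V) (b : nat -> W) (delta eps : R) :
  locally_matricial V -> locally_matricial W -> tuple_extension W ->
  0 < delta <= 1 -> 0 < eps -> similar n (1 + delta) a b ->
  exists2 b' : nat -> W, similar n.+1 (1 + eps) a b' &
    forall i, (i < n)%N -> osnorm (b' i - b i) <= 8 * delta * osnorm (a i).
Proof.
move=> VM WM WQ /andP[d0 dle1] e0 ab.
(* The first extension costs [K ^+ 4], so [a] and [d] are similar with constant [K ^+ 5]; the second
   needs more than its cube, and [K ^+ 16] suffices. *)
have [K K1] : exists2 K, 1 < K & K ^+ 16 < Num.min (1 + delta) (1 + eps).
  by apply: exists_exp_lt; rewrite lt_min !ltrDl d0.
rewrite lt_min => /andP[Kd Ke].
have K0 : 0 < K by rewrite (lt_trans ltr01).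
have Kexp i j : (i <= j)%N -> K ^+ i <= K ^+ j by by move=> ij; rewrite ler_eXn2l.
have KKd : K * K <= 1 + delta.
  by rewrite -expr2 (le_trans (Kexp _ 16%N _)) // ltW.
have [p [g [h [ag hb gh]]]] := amalgamate VM WM K1 KKd d0 ab.
(* The copy of [b] comes first, since its images are prescribed; the copy of [a] fills the last [n]
   places. *)
pose c i := if (i < n)%N then h i else g (i - n)%N.
have cb : similar n K c b.
  by apply: eq_similar hb => // i lin; rewrite /c lin.
have [||b1 b1E cb1] := WQ _ (n + n)%N n c b K (K ^+ 4)
  (@locally_matricial_matrix R p) (leq_addr _ _) (ltW K1).
- by rewrite ltr_eXn2l.
- by [].
pose d i := b1 (n + i)%N.
have gd : similar n (K ^+ 4) g d.
  have /similar_reindex/(_ cb1) : forall j, (j < n)%N -> (n + j < n + n)%N.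
    by move=> j jn; rewrite ltn_add2l.
  by apply: eq_similar => // i lin; rewrite /= /c ltnNge leq_addr addKn.
have ad : similar n (K ^+ 5) a d.
  rewrite exprSr; exact: (similar_trans (ltW K0) (exprn_ge0 _ (ltW K0)) ag gd).
have [||b2 b2E ab2] := WQ _ n.+1 n a d (K ^+ 5) (K ^+ 16) VM (leqnSn n) _ _ ad.
- by rewrite exprn_ege1 // ltW.
- by rewrite -exprM ltr_eXn2l.
exists b2; first exact: similar_le (ltW Ke) ab2.
(* As [g] and [h] are parts of one extended tuple, [d i - b i] is the image of [g i - h i]. The 8 is
   [K ^+ 5 * 2 * (1 + delta)] with [K ^+ 5 <= 2] and [delta <= 1]. *)
move=> i lin; rewrite b2E // -[b i]b1E // /d.
have inn : (i < n + n)%N by rewrite (leq_trans lin) ?leq_addr.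
have ninn : (n + i < n + n)%N by rewrite ltn_add2l.
rewrite (le_trans (dominates_osnormB ninn inn cb1.1)) //.
rewrite /c lin ltnNge leq_addr /= addKn.
rewrite (le_trans (ler_wpM2l _ (gh i lin))) ?exprn_ge0 ?(ltW K0) // mulrA.
rewrite ler_wpM2r ?osnorm_ge0 //.
have -> : K ^+ 4 * (2 * K * delta * (1 + delta))
   = K ^+ 5 * (2 * (1 + delta)) * delta by ring.
rewrite ler_wpM2r ?(ltW d0) //.
have K5 : K ^+ 5 <= 2.
  by rewrite (le_trans (Kexp _ 16%N _)) // (le_trans (ltW Kd)) //; lra.
nra.
Qed.

End Correction.

(** * Limits of similar tuples, and the isometry given by dense sequences *)

Section BackAndForth.
Context {R : realType}.
Implicit Types V W : opSpaceType R.

Definition half_pow k : R := 2^-1 ^+ k.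

Lemma half_pow_gt0 k : 0 < half_pow k.
Proof. by rewrite exprn_gt0 // invr_gt0 ltr0n. Qed.

Lemma half_powS k : half_pow k = 2 * half_pow k.+1.
Proof. by rewrite /half_pow exprS mulrA mulfV ?mul1r // pnatr_eq0. Qed.

Lemma half_powD_le k p : half_pow (k + p) <= half_pow k.
Proof.
elim: p => [|p IH]; first by rewrite addn0.
by have := half_powS (k + p); have := half_pow_gt0 (k + p).+1; rewrite addnS; lra.
Qed.

Lemma half_pow_small (e : R) : 0 < e -> exists k, half_pow k < e.
Proof.
move=> e0; have := @cvg_geometric R 1 2^-1 _.
rewrite ger0_norm ?invr_ge0 ?ler0n // invf_lt1 ?ltr0n // ltr1n => /(_ erefl).
move=> /cvgrPdist_lt/(_ e e0)[k _ /(_ k (leqnn k))] /=.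
rewrite sub0r normrN mul1r ger0_norm; last exact/ltW/half_pow_gt0.
by exists k.
Qed.

Lemma le_half_pow_lim (x y M : R) N :
  (forall k, (N <= k)%N -> x <= y + half_pow k * M) -> x <= y.
Proof.
move=> xy; rewrite leNgt; apply/negP => yx.
have M1 : 0 < `|M| + 1 by rewrite ltr_wpDl.
have e0 : 0 < (x - y) / (`|M| + 1) by rewrite divr_gt0 // subr_gt0.
have [k] := half_pow_small e0; rewrite ltr_pdivlMr // => kxy.
have /(_ (leq_addl _ _)) := xy (k + N)%N.
have := half_powD_le k N; have := half_pow_gt0 (k + N).
have := ler_norm M; have := normr_ge0 M.
move: (half_pow (k + N)) (half_pow k) kxy => h h' ????; nra.
Qed.

(** For fixed coefficients [A], the norm of [lincomb n A] depends continuously on the tuple, so the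
    inequalities pass to the limit one [A] at a time. *)
Lemma dominates_limit V W n N (a' : nat -> nat -> V) (b' : nat -> nat -> W) a b :
  (forall k, (N <= k)%N -> dominates n (1 + half_pow k) (a' k) (b' k)) ->
  (forall k i, (N <= k)%N -> (i < n)%N -> osnorm (a' k i - a i) <= 2 * half_pow k) ->
  (forall k i, (N <= k)%N -> (i < n)%N -> osnorm (b' k i - b i) <= 2 * half_pow k) ->
  dominates n 1 a b.
Proof.
move=> ab ala blb k A; rewrite mul1r.
have [C C0 CV] := mxnorm_lincomb_le V n A.
have [D D0 DW] := mxnorm_lincomb_le W n A.
have sumn (F : nat -> R) h : (forall i, (i < n)%N -> F i <= h) ->
    \sum_(i < n) F i <= n%:R * h.
  move=> Fh; apply: (@le_trans _ _ (\sum_(i < n) h)); last first.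
    by rewrite sumr_const card_ord mulr_natl.
  by apply: ler_sum => i _; exact: Fh.
(* The error constant comes from expanding [(1 + h) * (x + 2 * c * h) + 2 * d * h] and using
   [h <= 1]. *)
apply: (@le_half_pow_lim _ _
  (mxnorm (lincomb n A a) + 4 * (C * n%:R) + 2 * (D * n%:R)) N) => j Nj.
have h0 := half_pow_gt0 j.
have h1 : half_pow j <= 1 by have := half_powD_le 0 j; rewrite add0n /half_pow expr0.
have aj : mxnorm (lincomb n A (a' j)) <=
    mxnorm (lincomb n A a) + C * n%:R * (2 * half_pow j).
  rewrite -[lincomb n A (a' j)](subrK (lincomb n A a)) -lincombB addrC.
  rewrite (le_trans (mxnormD _ _ _)) // lerD2l (le_trans (CV _)) // -mulrA.
  by rewrite ler_wpM2l // (sumn (fun i => osnorm (a' j i - a i))) // => i; exact: ala.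
have bj : mxnorm (lincomb n A b) <=
    mxnorm (lincomb n A (b' j)) + D * n%:R * (2 * half_pow j).
  rewrite -[lincomb n A b](subrK (lincomb n A (b' j))) -lincombB addrC.
  rewrite (le_trans (mxnormD _ _ _)) // lerD2l (le_trans (DW _)) // -mulrA.
  rewrite ler_wpM2l // (sumn (fun i => osnorm (b i - b' j i))) // => i lin.
  by rewrite osnorm_distC; exact: blb.
have abj := ab j Nj k A.
have Cn : 0 <= C * n%:R by rewrite mulr_ge0.
have N0 := mxnorm_ge0 (lincomb n A a).
move: (mxnorm (lincomb n A a)) (mxnorm (lincomb n A b)) (mxnorm (lincomb n A (a' j)))
  (mxnorm (lincomb n A (b' j))) (C * n%:R) (D * n%:R) (half_pow j)
  h0 h1 aj bj abj Cn N0 => x y x' y' c d h h0 h1 aj bj abj c0 x0.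
have : (1 + h) * x' <= (1 + h) * (x + c * (2 * h)) by rewrite ler_pM2l //; lra.
have : c * h * h <= c * h * 1 by rewrite ler_wpM2l // mulr_ge0 // ltW.
by lra.
Qed.

Lemma complete_geometric V (x : nat -> V) N : os_complete V ->
  (forall k, (N <= k)%N -> osnorm (x k.+1 - x k) <= half_pow k) ->
  exists l, forall k, (N <= k)%N -> osnorm (x k - l) <= 2 * half_pow k.
Proof.
move=> VC xk.
(* The subtracted tail of the geometric series lets the induction on [p] close. *)
have xD k p : (N <= k)%N ->
    osnorm (x (k + p)%N - x k) <= 2 * half_pow k - 2 * half_pow (k + p).
  move=> Nk; elim: p => [|p IH]; first by rewrite addn0 !subrr osnorm0.
  rewrite addnS (le_trans (osnorm_triangle _ (x (k + p)%N) _)) //.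
  have := xk (k + p)%N (leq_trans Nk (leq_addr _ _)).
  by have := half_powS (k + p); lra.
have xD2 k p : (N <= k)%N -> osnorm (x (k + p)%N - x k) <= 2 * half_pow k.
  by move=> Nk; have := xD k p Nk; have := half_pow_gt0 (k + p); lra.
have [|l xl] := VC x.
  move=> e e0; have e4 : 0 < e / 4 by lra.
  have [K Ke] := half_pow_small e4.
  have far m : (N + K <= m)%N -> osnorm (x m - x (N + K)%N) < e / 2.
    move=> NKm; rewrite -(subnKC NKm).
    apply: le_lt_trans (xD2 _ _ (leq_addr _ _)) _.
    by have := half_powD_le K N; rewrite addnC; lra.
  near=> m n.
  rewrite (le_lt_trans (osnorm_triangle _ (x (N + K)%N) _)) //.
  have : osnorm (x m - x (N + K)%N) < e / 2.
    by apply: far; near: m; exact: nbhs_infty_ge.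
  have : osnorm (x n - x (N + K)%N) < e / 2.
    by apply: far; near: n; exact: nbhs_infty_ge.
  by rewrite [in X in X -> _]osnorm_distC; lra.
exists l => k Nk; apply/ler_addgt0Pr => e e0.
move/cvgrPdist_lt: xl => /(_ e e0)[M _ xM].
have /= := xM (k + M)%N (leq_addl _ _).
rewrite sub0r normrN ger0_norm ?osnorm_ge0 // => kM.
rewrite (le_trans (osnorm_triangle _ (x (k + M)%N) _)) // lerD ?(ltW kM) //.
by rewrite osnorm_distC xD2.
Unshelve. all: by end_near.
Qed.

Lemma matrix_lincomb (V : lmodType R[i]) k (x : 'M[V]_k) : exists n A a,
  x = lincomb n A a.
Proof.
pose T : finType := ('I_k * 'I_k)%type.
pose p t : option T := omap enum_val (insub t : option 'I_#|T|).
exists #|T|, (fun t => if p t is Some q then delta_mx q.1 q.2 else 0),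
  (fun t => if p t is Some q then x q.1 q.2 else 0).
apply/matrixP => r s; rewrite mxE.
under eq_bigr do rewrite /p valK /=.
rewrite -(big_enum_val (A := T) (fun q => (delta_mx q.1 q.2 : 'M_k) r s *: x q.1 q.2)).
rewrite (bigD1 (r, s)) //= mxE !eqxx scale1r big1 ?addr0 // => -[r' s'] /= ne.
by rewrite mxE (eq_sym r) (eq_sym s) -xpair_eqE (negbTE ne) scale0r.
Qed.

Section Closure.
Context (V W : opSpaceType R) (a : nat -> V) (b : nat -> W).
Context (ab : forall n, similar n 1 a b).

(** This is the closure of the set of pairs [(a i, b i)]; it becomes the graph of the isometry. *)
Definition tuple_closure (x : V) (y : W) : Prop := forall e : R, 0 < e ->
  exists i, osnorm (a i - x) < e /\ osnorm (b i - y) < e.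

(** Approximating pairs are reindexed pairs [(a i, b i)], similar with constant 1, and similarity
    survives the limit. Pairs of entries yield single-valuedness and injectivity, triples yield
    linearity, and longer tuples the complete isometry. *)
Lemma tuple_closure_similar n (x : nat -> V) (y : nat -> W) :
  (forall i, (i < n)%N -> tuple_closure (x i) (y i)) -> similar n 1 x y.
Proof.
move=> xy.
have /choice[sg sgE] : forall k, exists sg : nat -> nat, forall i, (i < n)%N ->
    osnorm (a (sg i) - x i) <= 2 * half_pow k /\
    osnorm (b (sg i) - y i) <= 2 * half_pow k.
  move=> k; suff /choice[sg sgE] : forall i, exists j, (i < n)%N ->
      osnorm (a j - x i) <= 2 * half_pow k /\
      osnorm (b j - y i) <= 2 * half_pow k by exists sg.
  move=> i; have [lin|_] := boolP (i < n)%N; last by exists 0%N.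
  have [j [aj bj]] := xy i lin _ (half_pow_gt0 k).
  by have := half_pow_gt0 k; exists j => _; split; lra.
have sab k : similar n (1 + half_pow k) (a \o sg k) (b \o sg k).
  have /similar_reindex : forall j, (j < n)%N ->
      (sg k j < (\sum_(i < n) sg k i).+1)%N.
    by move=> j jn; rewrite ltnS (bigD1 (Ordinal jn)) //= leq_addr.
  move=> /(_ _ _ _ _ _ _ (ab _)); apply: similar_le.
  by rewrite lerDl ltW // half_pow_gt0.
split.
- apply: (@dominates_limit _ _ _ 0 (fun k => a \o sg k) (fun k => b \o sg k)).
  + by move=> k _; exact: (sab k).1.
  + by move=> k i _ lin; exact: (sgE k i lin).1.
  + by move=> k i _ lin; exact: (sgE k i lin).2.
- apply: (@dominates_limit _ _ _ 0 (fun k => b \o sg k) (fun k => a \o sg k)).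
  + by move=> k _; exact: (sab k).2.
  + by move=> k i _ lin; exact: (sgE k i lin).2.
  + by move=> k i _ lin; exact: (sgE k i lin).1.
Qed.

Lemma tuple_closure_total : os_complete W ->
  (forall x (e : R), 0 < e -> exists i, osnorm (a i - x) < e) ->
  forall x, exists y, tuple_closure x y.
Proof.
move=> WC ad x.
have /choice[f fE] := fun k => ad x _ (half_pow_gt0 k.+1).
have [|y yE] := @complete_geometric W (b \o f) 0 WC.
  move=> k _; have := @dominates_osnormB _ _ _ (f k.+1 + f k).+1 1 (f k.+1) (f k) a b.
  rewrite !ltnS leq_addr leq_addl => /(_ erefl erefl (ab _).1) /=; rewrite mul1r.
  move=> /le_trans; apply; rewrite (le_trans (osnorm_triangle _ x _)) //.
  have := fE k; have := fE k.+1; rewrite [in X in _ -> X -> _]osnorm_distC.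
  by have := half_powS k; have := half_powS k.+1; have := half_pow_gt0 k.+2; lra.
exists y => e e0; have e2 : 0 < e / 2 by lra.
have [k ke] := half_pow_small e2; exists (f k); split.
  by have := fE k; have := half_powS k; have := half_pow_gt0 k.+1; lra.
by have := yE k (leq0n k) => /=; lra.
Qed.

End Closure.

Lemma tuple_closure_sym V W (a : nat -> V) (b : nat -> W) x y :
  tuple_closure a b x y -> tuple_closure b a y x.
Proof. by move=> xy e /xy[i []]; exists i. Qed.

Lemma completely_isometric_of_dense V W (a : nat -> V) (b : nat -> W) :
  os_complete V -> os_complete W ->
  (forall x (e : R), 0 < e -> exists i, osnorm (a i - x) < e) ->
  (forall y (e : R), 0 < e -> exists i, osnorm (b i - y) < e) ->
  (forall n, similar n 1 a b) ->
  completely_isometrically_isomorphic V W.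
Proof.
move=> VC WC ad bd ab.
have ba n : similar n 1 b a by exact: similar_sym.
have /choice[f fE] := tuple_closure_total ab WC ad.
have /choice[g gE] := tuple_closure_total ba VC bd.
have tE := tuple_closure_similar ab.
have eqV x x' y : tuple_closure a b x y -> tuple_closure a b x' y -> x = x'.
  move=> xy x'y; apply/eqP; rewrite -subr_eq0; apply/eqP/osnorm_eq0.
  have /tE[_ /(dominates_osnormB (n := 2) (i := 0) (j := 1) isT isT)] :
      forall i, (i < 2)%N -> tuple_closure a b (if i == 0%N then x else x') y.
    by case.
  by rewrite /= subrr osnorm0 mulr0 => xx; apply/eqP; rewrite eq_le osnorm_ge0 andbT.
have eqW x y y' : tuple_closure a b x y -> tuple_closure a b x y' -> y = y'.
  move=> xy xy'; apply/eqP; rewrite -subr_eq0; apply/eqP/osnorm_eq0.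
  have /tE[/(dominates_osnormB (n := 2) (i := 0) (j := 1) isT isT) + _] :
      forall i, (i < 2)%N -> tuple_closure a b x (if i == 0%N then y else y').
    by case.
  by rewrite /= subrr osnorm0 mulr0 => xx; apply/eqP; rewrite eq_le osnorm_ge0 andbT.
have fK : cancel f g by move=> x; apply: (eqV _ _ (f x)) => //; exact/tuple_closure_sym/gE.
have gK : cancel g f by move=> y; apply: (eqW (g y)) => //; exact/tuple_closure_sym/gE.
have flin : linear f.
  move=> c x y; set z := c *: x + y.
  (* The relation [c *: x + y - z = 0] on the left forces the same relation among the images. *)
  have /tE[+ _] : forall i, (i < 3)%N ->
      tuple_closure a b ([:: x; y; z]`_i) ([:: f x; f y; f z]`_i).
    by move=> [|[|[|//]]] _; exact: fE.
  move=> /(dominates_osnorm (fun i => [:: c; 1; -1]`_i)).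
  rewrite !big_ord_recl !big_ord0 /= !scale1r !scaleN1r !addr0.
  rewrite [in leRHS]addrA subrr osnorm0 mulr0 => fz.
  apply/esym/eqP; rewrite -subr_eq0 -addrA; apply/eqP/osnorm_eq0/eqP.
  by rewrite eq_le osnorm_ge0 andbT.
have glin : linear g by move=> c x y; apply: (canLR fK); rewrite flin !gK.
pose F : {linear V -> W} := HB.pack f (GRing.isLinear.Build R[i] V W _ f flin).
pose G : {linear W -> V} := HB.pack g (GRing.isLinear.Build R[i] W V _ g glin).
exists (@LinIso R V W F G fK gK) => k x.
have [n [A [u ->]]] := matrix_lincomb x.
rewrite map_lincomb; apply/eqP; rewrite eq_le.
have [/(_ k A) + /(_ k A)] := tE n u (f \o u) (fun i _ => fE (u i)).
by rewrite !mul1r => -> ->.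
Qed.

End BackAndForth.

(** * The back-and-forth construction and the conclusion *)

Section Construction.
Context {R : realType}.
Implicit Types V W : opSpaceType R.

(** Every ball must be visited arbitrarily late, because stage [k] of the construction approximates
    [u k] only up to [half_pow k]. *)
Lemma separable_dense_sequence V : os_separable V -> exists u : nat -> V,
  forall x (e : R) N, 0 < e -> exists2 k, (N <= k)%N & osnorm (u k - x) < e.
Proof.
move=> [D [/countable_injP[f finj] Dd]].
have /choice[g gE] : forall m, exists y : V, forall z, D z -> f z = m -> z = y.
  move=> m; have [[z [Dz fz]]|no] := pselect (exists z, D z /\ f z = m).
    by exists z => z' Dz' fz'; apply: finj; rewrite ?inE // fz fz'.
  by exists 0 => z Dz fz; exfalso; apply: no; exists z.
(* [logn 2 k] takes every value for arbitrarily large [k]. *)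
exists (fun k => g (logn 2 k)) => x e N e0.
have [y Dy xy] := Dd x e e0.
exists (2 ^ f y * (2 * N).+1)%N.
  by rewrite (@leq_trans (2 * N).+1) ?leq_pmull ?expn_gt0 // ltnW // ltnS leq_pmull.
rewrite lognM ?expn_gt0 // pfactorK // lognE /= dvdn2 /= oddM /= addn0.
by rewrite -(gE (f y) y) // osnorm_distC.
Qed.

Lemma lincomb0 (V : lmodType R[i]) k (A : nat -> 'M[R[i]]_k) (a : nat -> V) :
  lincomb 0 A a = 0.
Proof. by apply/matrixP => r s; rewrite !mxE big_ord0. Qed.

(** The last two bounds say that the next correction, on either side, moves each entry by at most
    [eta]. *)
Definition close_tuples V W (eta : R) n (a : nat -> V) (b : nat -> W) : Prop :=
  exists delta : R, [/\ 0 < delta <= 1, delta <= eta, similar n (1 + delta) a b,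
    forall i, (i < n)%N -> 8 * delta * osnorm (a i) <= eta &
    forall i, (i < n)%N -> 8 * delta * osnorm (b i) <= eta].

Lemma close_tuples_sym V W eta n (a : nat -> V) (b : nat -> W) :
  close_tuples eta n a b -> close_tuples eta n b a.
Proof. by move=> [d [d1 de ab ae be]]; exists d; split=> //; exact: similar_sym. Qed.

Lemma eq_close_tuples V W eta n (a a' : nat -> V) (b : nat -> W) :
  (forall i, (i < n)%N -> a i = a' i) ->
  close_tuples eta n a b -> close_tuples eta n a' b.
Proof.
move=> aa [d [d1 de ab ae be]]; exists d; split=> // [|i lin].
  exact: eq_similar ab.
by rewrite -aa // ae.
Qed.

Lemma close_tuples_extend V W n (a : nat -> V) (b : nat -> W) (eta eta' : R) :
  locally_matricial V -> locally_matricial W -> tuple_extension W ->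
  close_tuples eta n a b -> 0 < eta' ->
  exists2 b' : nat -> W, close_tuples eta' n.+1 a b' &
    forall i, (i < n)%N -> osnorm (b' i - b i) <= eta.
Proof.
move=> VM WM WQ [d [d1 de ab ae be]] eta0.
pose M := 1 + \sum_(i < n.+1) osnorm (a i).
have aM i : (i < n.+1)%N -> osnorm (a i) <= M.
  move=> lin; rewrite /M (bigD1 (Ordinal lin)) //= addrCA lerDl addr_ge0 //.
  by apply: sumr_ge0 => j _; exact: osnorm_ge0.
have M1 : 1 <= M by rewrite lerDl; apply: sumr_ge0 => j _; exact: osnorm_ge0.
have M0 : 0 < M by rewrite (lt_le_trans ltr01).
pose m := Num.min 1 eta'.
have m0 : 0 < m by rewrite lt_min ltr01.
have m1 : m <= 1 by rewrite ge_min lexx.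
have me : m <= eta' by rewrite ge_min lexx orbT.
(* Entries of [a] are at most [M] and those of [b'] at most [(1 + eps) * M <= 2 * M], so [8 * eps]
   times either is at most [m]. *)
pose eps := m / (16 * M).
have epsM : 16 * eps * M = m by rewrite /eps; field; rewrite gt_eqF.
have eps0 : 0 < eps by rewrite divr_gt0 // mulr_gt0.
clearbody eps M m.
have [b' ab' b'b] := correct_and_extend VM WM WQ d1 eps0 ab.
exists b'.
  have eps1 : eps <= m by nra.
  exists eps; split=> // [|||i lin]; try by lra.
    move=> i lin; have := aM i lin; have := osnorm_ge0 (a i); nra.
  have := dominates_osnorm1 lin ab'.1; have := aM i lin.
  have := osnorm_ge0 (a i).
  move: (osnorm (a i)) (osnorm (b' i)) => x y x0 xM yx.
  have : y <= 2 * M by nra.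
  by move=> yM; nra.
by move=> i lin; rewrite (le_trans (b'b i lin)) // ae.
Qed.

Definition update (V : Type) (a : nat -> V) n (x : V) i := if i == n then x else a i.

Lemma updateE (V : Type) (a : nat -> V) n x i : (i < n)%N -> a i = update a n x i.
Proof. by rewrite /update => /ltn_eqF->. Qed.

(** Forth, then back: [x] is put in place [n] of [a] and gets an image; then [y] is put in place
    [n.+1] of the new [b], and the roles are exchanged. The second half may move [x], which is why
    [a' n] only approximates it. *)
Lemma close_tuples_step V W n (a : nat -> V) (b : nat -> W) (eta eta' : R) x y :
  locally_matricial V -> locally_matricial W ->
  tuple_extension V -> tuple_extension W ->
  close_tuples eta n a b -> 0 < eta' <= eta ->
  exists a' b', [/\ close_tuples eta' n.+2 a' b',
    forall i, (i < n)%N -> osnorm (a' i - a i) <= eta,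
    forall i, (i < n)%N -> osnorm (b' i - b i) <= eta,
    osnorm (a' n - x) <= eta & osnorm (b' n.+1 - y) <= eta].
Proof.
move=> VM WM VQ WQ ab /andP[eta0 etale].
have := close_tuples_extend VM WM WQ (eq_close_tuples (@updateE _ a n x) ab) eta0.
move=> [b1 ab1 bb1].
have := close_tuples_extend WM VM VQ (eq_close_tuples (@updateE _ b1 n.+1 y)
  (close_tuples_sym ab1)) eta0.
move=> [a2 ba2 aa2].
exists a2, (update b1 n.+1 y); split.
- exact: close_tuples_sym.
- move=> i lin; rewrite (updateE a x lin); apply: le_trans etale.
  exact/aa2/ltnW.
- by move=> i lin; rewrite -updateE ?bb1 // ltnW.
- by have := aa2 n (ltnSn n); rewrite /update eqxx => /le_trans; apply.
- by rewrite /update eqxx subrr osnorm0 (le_trans (ltW eta0)).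
Qed.

Lemma close_tuples_chain V W (u : nat -> V) (v : nat -> W) :
  locally_matricial V -> locally_matricial W ->
  tuple_extension V -> tuple_extension W ->
  exists (a : nat -> nat -> V) (b : nat -> nat -> W), forall k,
  [/\ close_tuples (half_pow k) k.*2 (a k) (b k),
      forall i, (i < k.*2)%N -> osnorm (a k.+1 i - a k i) <= half_pow k,
      forall i, (i < k.*2)%N -> osnorm (b k.+1 i - b k i) <= half_pow k,
      osnorm (a k.+1 k.*2 - u k) <= half_pow k &
      osnorm (b k.+1 k.*2.+1 - v k) <= half_pow k].
Proof.
move=> VM WM VQ WQ.
pose T := ((nat -> V) * (nat -> W))%type.
(* The step is made total so that it can be iterated: off the invariant it returns its input. *)
have /choice[F FE] : forall ks : nat * T, exists t : T,
    close_tuples (half_pow ks.1) ks.1.*2 ks.2.1 ks.2.2 ->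
    [/\ close_tuples (half_pow ks.1.+1) ks.1.+1.*2 t.1 t.2,
      forall i, (i < ks.1.*2)%N -> osnorm (t.1 i - ks.2.1 i) <= half_pow ks.1,
      forall i, (i < ks.1.*2)%N -> osnorm (t.2 i - ks.2.2 i) <= half_pow ks.1,
      osnorm (t.1 ks.1.*2 - u ks.1) <= half_pow ks.1 &
      osnorm (t.2 ks.1.*2.+1 - v ks.1) <= half_pow ks.1].
  move=> [k [a b]] /=.
  have [ab|nab] := pselect (close_tuples (half_pow k) k.*2 a b); last first.
    by exists (a, b).
  have hk : 0 < (half_pow k.+1 : R) <= half_pow k.
    rewrite half_pow_gt0 (half_powS k).
    by rewrite ler_peMl ?ler1n // ltW // half_pow_gt0.
  have [a' [b' H]] := close_tuples_step (u k) (v k) VM WM VQ WQ ab hk.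
  by exists (a', b').
pose S := fix S k : T := if k is k'.+1 then F (k', S k') else (fun=> 0, fun=> 0).
have SE k : close_tuples (half_pow k) k.*2 (S k).1 (S k).2.
  elim: k => [|k IH]; last by have [] := FE (k, S k) IH.
  (* Empty tuples are close with [delta = 1 = half_pow 0]. *)
  exists 1; split=> //; first by rewrite ltr01 lexx.
  by split=> k A; rewrite !lincomb0 !mxnorm0 mulr0.
exists (fun k => (S k).1), (fun k => (S k).2) => k.
by have [] := FE (k, S k) (SE k); split.
Qed.

Lemma tuple_extension_isometric V W :
  os_complete V -> os_complete W -> os_separable V -> os_separable W ->
  locally_matricial V -> locally_matricial W ->
  tuple_extension V -> tuple_extension W ->
  completely_isometrically_isomorphic V W.
Proof.
move=> VC WC /separable_dense_sequence[u ud] /separable_dense_sequence[v vd].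
move=> VM WM VQ WQ.
have [a [b ab]] := close_tuples_chain u v VM WM VQ WQ.
have lim (U : opSpaceType R) (c : nat -> nat -> U) : os_complete U ->
    (forall k i, (i < k.*2)%N -> osnorm (c k.+1 i - c k i) <= half_pow k) ->
    exists l, forall i k, (i < k.*2)%N -> osnorm (c k i - l i) <= 2 * half_pow k.
  move=> UC cc.
  (* Entry [i] is controlled from stage [i./2.+1] on, the first [k] with [i < k.*2]. *)
  suff /choice[l lE] : forall i, exists l,
      forall k, (i./2.+1 <= k)%N -> osnorm (c k i - l) <= 2 * half_pow k.
    by exists l => i k ik; apply: lE; rewrite ltn_half_double.
  move=> i; apply: (@complete_geometric R U (fun k => c k i)) => // k.
  by rewrite ltn_half_double; exact: cc.
have [a' a'E] : exists l, forall i k, (i < k.*2)%N -> osnorm (a k i - l i) <= 2 * half_pow k.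
  by apply: lim => // k; have [] := ab k.
have [b' b'E] : exists l, forall i k, (i < k.*2)%N -> osnorm (b k i - l i) <= 2 * half_pow k.
  by apply: lim => // k; have [] := ab k.
have i_lt2 n k i : (n <= k)%N -> (i < n)%N -> (i < k.*2)%N.
  by move=> nk lin; rewrite (leq_trans lin) // (leq_trans nk) // -addnn leq_addr.
have abk n k : (n <= k)%N -> similar n (1 + half_pow k) (a k) (b k).
  move=> nk; have [[d [_ dk abd _ _]] _ _ _ _] := ab k.
  apply: (similar_le (K := 1 + d)); first by rewrite lerD2l.
  by apply: (similar_reindex (f := id) _ abd) => i; exact: i_lt2.
(* The limit entry in place [s k] differs from [w k] by at most [2 * half_pow k]: half of it is the
   tail of corrections after stage [k.+1], half the error when [w k] was inserted. *)
have near_dense (U : opSpaceType R) (c : nat -> nat -> U) (l w : nat -> U) s :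
    (forall k, s k < k.+1.*2)%N ->
    (forall i k, (i < k.*2)%N -> osnorm (c k i - l i) <= 2 * half_pow k) ->
    (forall k, osnorm (c k.+1 (s k) - w k) <= half_pow k) ->
    (forall x (e : R) N, 0 < e -> exists2 k, (N <= k)%N & osnorm (w k - x) < e) ->
    forall x (e : R), 0 < e -> exists i, osnorm (l i - x) < e.
  move=> sk cl cw wd x e e0; have e4 : 0 < e / 4 by lra.
  have [N Ne] := half_pow_small e4; have [k Nk wx] := wd x _ N e4.
  exists (s k).
  have kN : (half_pow k : R) <= half_pow N by rewrite -(subnKC Nk) half_powD_le.
  rewrite (le_lt_trans (osnorm_triangle _ (w k) _)) //.
  have := osnorm_triangle (l (s k)) (c k.+1 (s k)) (w k).
  rewrite (osnorm_distC (l _) (c _ _)).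
  by have := cl _ _ (sk k); have := cw k; have := @half_powS R k; lra.
apply: (@completely_isometric_of_dense R V W a' b') => //.
- apply: (near_dense V a a' u double) => // k.
  by have [] := ab k.
- apply: (near_dense W b b' v (fun k => k.*2.+1)) => // k.
  by have [] := ab k.
move=> n; split.
- apply: (@dominates_limit R V W n n a b) => k; first by move/abk=> [].
    by move=> i nk lin; apply: a'E; exact: i_lt2 lin.
  by move=> i nk lin; apply: b'E; exact: i_lt2 lin.
- apply: (@dominates_limit R W V n n b a) => k; first by move/abk=> [].
    by move=> i nk lin; apply: b'E; exact: i_lt2 lin.
  by move=> i nk lin; apply: a'E; exact: i_lt2 lin.
Qed.

Lemma nearly_isometric_separable V W :
  nearly_isometric V W -> os_separable W -> os_separable V.
Proof.
move=> VW [D [Dc Dd]]; have [f [l [l0 fl]]] := VW 2 (ltr1n _ 2).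
exists (iso_inv f @` D); split; first exact: card_le_trans (card_image_le _ _) Dc.
move=> x e e0; have [|y Dy fy] := Dd (f x) (e / (2 * l)).
  by rewrite divr_gt0 // mulr_gt0.
exists (iso_inv f y); first by exists y.
have /andP[_] := fl _ (const_mx (x - iso_inv f y) : 'M_1).
rewrite map_const_mx linearB iso_invK => /le_lt_trans; apply.
by move: fy; rewrite ltr_pdivlMr ?mulr_gt0 // mulrA mulrC.
Qed.

End Construction.

Theorem theorem3p2 (R : realType) (NG X : opSpaceType R)
  (hNG : nc_gurariy NG) (hX : os_complete X) (hd : d_cb X NG = 1%E) :
  completely_isometrically_isomorphic X NG.
Proof.
have [NGC NGS /exact_locally_matricial NGM /extension_property_tuple NGQ] := hNG.
have XNG := d_cb1_nearly_isometric hd.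
apply: tuple_extension_isometric => //.
- exact: nearly_isometric_separable XNG NGS.
- exact: nearly_isometric_matricial XNG NGM.
- exact: nearly_isometric_tuple_extension XNG NGQ.
Qed.
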